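(* Let $\Lambda$ be an artin algebra and let $\mathcal C$ be a minimal subcategory of $\operatorname{mod}\Lambda$. Then: (a) For any natural number $d$, there are only finitely many isomorphism classes of modules in $\mathcal C$ of length $d$. (b) Any module in $\mathcal C$ is isomorphic to a submodule of an indecomposable module in $\mathcal C$. (c) There is an infinite sequence of indecomposable modules $C_i$ ($i\ge 1$) in $\mathcal C$ with proper inclusions $$C_1\subset C_2\subset\cdots\subset C_i\subset C_{i+1}\subset\cdots$$ such that also the union $M=\bigcup_i C_i$ is indecomposable, and then $\mathcal C=\mathcal S_M$.
   Context: $\operatorname{mod}\Lambda$ is the category of $\Lambda$-modules of finite length. All subcategories of $\operatorname{mod}\Lambda$ are full subcategories closed under isomorphisms, finite direct sums and direct summands. A subcategory $\mathcal C$ is finite if it contains only finitely many isomorphism classes of indecomposable modules, and infinite otherwise. It is submodule-closed if for every module $C$ in $\mathcal C$, every submodule of $C$ belongs to $\mathcal C$. A subcategory $\mathcal C$ is called minimal (short for minimal infinite submodule-closed) if it is infinite and submodule-closed, and no proper subcategory of $\mathcal C$ is both infinite and submodule-closed. For a $\Lambda$-module $M$, not necessarily of finite length, $\mathcal S_M$ denotes the (full sub)category of all finite length $\Lambda$-modules cogenerated by $M$, i.e. those finite length modules $X$ for which the intersection of the kernels of all homomorphisms $X\to M$ is zero (equivalently, $X$ embeds into a finite direct sum of copies of $M$). *)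

(* Defs.v *)
From HB Require Import structures.
From mathcomp Require Import all_boot all_order all_algebra.

Set Implicit Arguments.
Unset Strict Implicit.
Unset Printing Implicit Defensive.

Import GRing.Theory.
Local Open Scope ring_scope.

(* Modules are left modules.  A full subcategory closed under isomorphisms is
   encoded by its objects, as an isomorphism-invariant predicate on lmodType A.
   Submodules are the boolean predicates of submodClosed; classically every
   subset of a module is given by such a predicate. *)

Definition submod (A : nzRingType) (M : lmodType A) (U : submodClosed M) :=
  {x : M | x \in U}.

HB.instance Definition _ (A : nzRingType) (M : lmodType A)
    (U : submodClosed M) := SubChoice.on (submod U).
HB.instance Definition _ (A : nzRingType) (M : lmodType A)
    (U : submodClosed M) := [SubChoice_isSubLmodule of submod U by <:].

Definition proper_submod (A : nzRingType) (M : lmodType A)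
    (U V : submodClosed M) : Prop :=
  {subset U <= V} /\ ~ {subset V <= U}.

Section Modules.
Variable A : nzRingType.
Implicit Types M X Y : lmodType A.

Definition isomorphic X Y : Prop := exists f : {linear X -> Y}, bijective f.

Definition zero_module M : Prop := forall x : M, x = 0.

Definition indecomposable M : Prop :=
  ~ zero_module M /\
  forall X Y, isomorphic M (X * Y)%type -> zero_module X \/ zero_module Y.

Definition artinian_module M : Prop :=
  forall U : nat -> submodClosed M,
    (forall i, {subset U i.+1 <= U i}) ->
    exists n, forall m, (n <= m)%N -> U m =i U n.

(* U i is covered by U i.+1, i.e. the factor U i.+1 / U i is simple. *)
Definition composition_series M (d : nat) (U : nat -> submodClosed M) : Prop :=
  [/\ forall x : M, (x \in U 0%N) = (x == 0),
      forall x : M, x \in U d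
    & forall i, (i < d)%N ->
        proper_submod (U i) (U i.+1) /\
        forall V : submodClosed M,
          {subset U i <= V} -> {subset V <= U i.+1} ->
          V =i U i \/ V =i U i.+1].

Definition has_length M (d : nat) : Prop :=
  exists U : nat -> submodClosed M, composition_series d U.

Definition finite_length M : Prop := exists d, has_length M d.

Definition finitely_many_iso_classes (P : lmodType A -> Prop) : Prop :=
  exists (n : nat) (Y : 'I_n -> lmodType A),
    forall X, P X -> exists i, isomorphic X (Y i).

(* Closure under finite direct sums: subcat_zero is the empty sum, subcat_sum
   the binary one.  For subcat_summand, an arbitrary direct summand of an object
   of C reduces to the first factor of a product by subcat_iso. *)
Record subcategory (C : lmodType A -> Prop) : Prop := Subcategory {
  subcat_length : forall X, C X -> finite_length X;
  subcat_zero : forall X, zero_module X -> C X;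
  subcat_sum : forall X Y, C X -> C Y -> C (X * Y)%type;
  subcat_iso : forall X Y, isomorphic X Y -> C X -> C Y;
  subcat_summand : forall X Y, C (X * Y)%type -> C X
}.

Definition finite_subcat (C : lmodType A -> Prop) : Prop :=
  finitely_many_iso_classes (fun X => C X /\ indecomposable X).

Definition infinite_subcat (C : lmodType A -> Prop) : Prop :=
  ~ finite_subcat C.

Definition submodule_closed (C : lmodType A -> Prop) : Prop :=
  forall X, C X -> forall U : submodClosed X, C (submod U).

Definition proper_subcat (D C : lmodType A -> Prop) : Prop :=
  (forall X, D X -> C X) /\ ~ (forall X, C X -> D X).

Definition minimal_subcat (C : lmodType A -> Prop) : Prop :=
  [/\ subcategory C, infinite_subcat C, submodule_closed C
    & ~ exists D, [/\ subcategory D, proper_subcat D C,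
                      infinite_subcat D & submodule_closed D]].

(* X ranges over the objects of the category S_M; M need not have finite
   length. *)
Definition cogenerated M X : Prop :=
  finite_length X /\
  forall x : X, (forall f : {linear X -> M}, f x = 0) -> x = 0.

End Modules.

(* algType R makes the scalars of R act through the centre of L; R^o is R as a
   module over itself, so its submodules are the ideals of R. *)
Definition artin_algebra (R : comNzRingType) (L : algType R) : Prop :=
  artinian_module R^o /\
  exists (n : nat) (g : 'I_n -> L),
    forall x : L, exists c : 'I_n -> R, x = \sum_(i < n) c i *: g i.

(* Main.v *)
Require Import Defs.
From HB Require Import structures.
From mathcomp Require Import all_boot all_order all_algebra.
From mathcomp Require Import generic_quotient ring_quotient.
From mathcomp Require Import boolp classical_sets functions.
From mathcomp Require Import zify.

(** Call an object [R] of [C] subdirectly irreducible if some nonzero element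
    of [R] is killed by every map from [R] to an object of [C] that is not
    injective.  Any other object is cogenerated by its proper factor modules in
    [C], so by induction on the length the subdirectly irreducible objects
    cogenerate [C] ([cogenerated_by_subdirectly_irreducible]).  They are
    indecomposable, and if such an [R] is cogenerated by a family of objects
    then it embeds into one of them.

    Minimality enters as follows: the objects of [C] cogenerated by an infinite
    family of indecomposables form an infinite submodule-closed subcategory, so
    the family cogenerates all of [C] ([infinite_family_cogenerates]).  Hence a
    subdirectly irreducible [R] embeds into a member of every infinite family
    of indecomposables.  Three consequences carry the proof.  There are
    infinitely many subdirectly irreducible objects: otherwise take [R]
    maximal; all but finitely many indecomposables [Y] contain [R], some map
    [Y -> R'] with [R'] subdirectly irreducible is injective on [R], hence
    bijective on [R] by maximality, so that [R] is a summand of [Y] and [Y = R].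
    Only finitely many of them have a given length, since otherwise one of the
    largest length would embed into another one.  And only finitely many indecomposables have a given
    length [d]: otherwise each of them would be cogenerated by the others, thus
    by their proper submodules, and modules of length less than [d] would
    cogenerate [C] and bound the lengths of the subdirectly irreducible ones.
    Finite direct sums then give (a).

    As there are infinitely many subdirectly irreducible objects, each of them
    is properly contained in another one, which yields a strict chain [X i].
    The [X i] cogenerate [C], so [C] consists of the modules of finite length
    cogenerated by the union [M].  If [M] decomposed, one of the two projections
    would be injective on [X i] for each [i], while for large [i] both kill a
    nonzero element of [X i]; this gives (c).

    For (b) every object of [C] embeds into some [X i] ([chain_cofinal]).  It
    suffices that [U * Z] does if [U] does and [Z] is subdirectly irreducible
    ([chain_embeds_prod]).  Suppose not, let [Y = X j] with [j] large and let
    [D] be a maximal submodule of [Y] that meets [U] in zero.  Then [Y / D] is an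
    essential extension of [U], of bounded length because the algebra is artin
    ([finite_essential_extension]), and [D] does not contain [Z], so it is a sum
    of indecomposables from a finite list.  Being long, [D] contains some
    [E ^ N] as a summand with [N] large.  Write [Y = D + V] with [V] of bounded
    length.  The [N] projections [D -> E] restricted to the intersection of [D]
    and [V] are linearly dependent over the base ring, so some copy of [E] splits
    off [D] with a projection that vanishes on this intersection; it then splits
    off [Y], and [Y = E] is not long after all. *)

Set Implicit Arguments.
Unset Strict Implicit.
Unset Printing Implicit Defensive.

Import GRing.Theory.
Local Open Scope classical_set_scope.
Local Open Scope ring_scope.

(** * Submodules and linear maps *)

Section Submodules.
Variable A : nzRingType.

Definition is_submod (M : lmodType A) (V : set M) : Prop :=
  V 0 /\ forall a x y, V x -> V y -> V (a *: x + y).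

Section Closure.
Variables (M : lmodType A) (V : set M) (sV : is_submod V).

Lemma is_submodD x y : V x -> V y -> V (x + y).
Proof. by move=> Vx Vy; rewrite -[x]scale1r; apply: sV.2. Qed.

Lemma is_submodZ a x : V x -> V (a *: x).
Proof. by move=> Vx; rewrite -[_ *: _]addr0; apply: sV.2 => //; apply: sV.1. Qed.

Lemma is_submodN x : V x -> V (- x).
Proof. by rewrite -scaleN1r; apply: is_submodZ. Qed.

Lemma is_submodB x y : V x -> V y -> V (x - y).
Proof. by move=> Vx Vy; apply: is_submodD => //; apply: is_submodN. Qed.

Definition set_submod_pred of is_submod V : {pred M} := fun x => `[< V x >].

Fact set_submod_closed : subsemimod_closed (set_submod_pred sV).
Proof.
split; first split.
- exact/asboolP/sV.1.
- by move=> x y /asboolP Vx /asboolP Vy; apply/asboolP/is_submodD.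
- by move=> a x /asboolP Vx; apply/asboolP/is_submodZ.
Qed.

HB.instance Definition _ :=
  GRing.isSubmodClosed.Build A M (set_submod_pred sV) set_submod_closed.

Definition of_set : submodClosed M := set_submod_pred sV.

Lemma mem_of_set x : (x \in of_set) = `[< V x >].
Proof. by []. Qed.

End Closure.

Section Linear.
Variables (X Y : lmodType A) (f : X -> Y) (lf : linear f).

Definition linear_fun of linear f : X -> Y := f.

HB.instance Definition _ :=
  GRing.isLinear.Build A X Y *:%R (linear_fun lf) lf.

Definition to_linear : {linear X -> Y} := linear_fun lf.

End Linear.


Definition msum (M : lmodType A) (V W : set M) : set M :=
  [set x | exists v w, [/\ V v, W w & x = v + w]].

(** The submodule [B + A v]. *)
Definition adjoin (M : lmodType A) (B : set M) (v : M) : set M :=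
  [set x | exists a, B (x - a *: v)].

Section Constructions.
Variable X : lmodType A.

Lemma is_submod0 : is_submod [set 0 : X].
Proof. by split=> [|a x y /= -> ->] //; rewrite /= scaler0 addr0. Qed.

Lemma is_submodT : is_submod [set: X].
Proof. by []. Qed.

Lemma sub0_submod (V : set X) : is_submod V -> [set 0] `<=` V.
Proof. by move=> sV _ ->; apply: sV.1. Qed.

Lemma is_submodI (V W : set X) :
  is_submod V -> is_submod W -> is_submod (V `&` W).
Proof.
move=> sV sW; split; first by split; [apply: sV.1|apply: sW.1].
by move=> a x y [Vx Wx] [Vy Wy]; split; [apply: sV.2|apply: sW.2].
Qed.

Lemma is_submod_sum (V W : set X) :
  is_submod V -> is_submod W -> is_submod (msum V W).
Proof.
move=> sV sW; split.
  by exists 0, 0; rewrite addr0; split=> //; [apply: sV.1|apply: sW.1].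
move=> a _ _ [v [w [Vv Ww ->]]] [v' [w' [Vv' Ww' ->]]].
exists (a *: v + v'), (a *: w + w'); split; [exact: sV.2|exact: sW.2|].
by rewrite scalerDr addrACA.
Qed.

Lemma sub_msuml (V W : set X) : is_submod W -> V `<=` msum V W.
Proof. by move=> sW v Vv; exists v, 0; rewrite addr0; split=> //; apply: sW.1. Qed.

Lemma sub_msumr (V W : set X) : is_submod V -> W `<=` msum V W.
Proof. by move=> sV w Ww; exists 0, w; rewrite add0r; split=> //; apply: sV.1. Qed.

Lemma msum_sub (V W T : set X) :
  is_submod T -> V `<=` T -> W `<=` T -> msum V W `<=` T.
Proof.
by move=> sT VT WT _ [v [w [/VT Tv /WT Tw ->]]]; apply: is_submodD.
Qed.

Lemma is_submod_adjoin (B : set X) v : is_submod B -> is_submod (adjoin B v).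
Proof.
move=> sB; split; first by exists 0; rewrite scale0r subr0; apply: sB.1.
move=> a x y [b Bx] [c By]; exists (a * b + c).
have -> : a *: x + y - (a * b + c) *: v = a *: (x - b *: v) + (y - c *: v).
  by rewrite scalerBr scalerA scalerDl opprD addrACA.
exact: sB.2.
Qed.

Lemma sub_adjoin (B : set X) v : B `<=` adjoin B v.
Proof. by move=> x Bx; exists 0; rewrite scale0r subr0. Qed.

Lemma mem_adjoin (B : set X) v : is_submod B -> adjoin B v v.
Proof. by move=> sB; exists 1; rewrite scale1r subrr; apply: sB.1. Qed.

Lemma adjoin_sub (B T : set X) v :
  is_submod T -> B `<=` T -> T v -> adjoin B v `<=` T.
Proof.
move=> sT BT Tv x [a /BT Tx]; rewrite -[x](subrK (a *: v)).
by apply: is_submodD => //; apply: is_submodZ.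
Qed.

End Constructions.

Section Maps.
Variables (X Y : lmodType A) (f : {linear X -> Y}).

Lemma is_submod_preimage (W : set Y) : is_submod W -> is_submod (f @^-1` W).
Proof.
move=> sW; split=> /=; first by rewrite linear0; apply: sW.1.
by move=> a x y Wx Wy /=; rewrite linearP; apply: sW.2.
Qed.

Lemma is_submod_image (V : set X) : is_submod V -> is_submod (f @` V).
Proof.
move=> sV; split; first by exists 0; rewrite ?linear0 //; apply: sV.1.
move=> a _ _ [x Vx <-] [y Vy <-]; exists (a *: x + y); first exact: sV.2.
by rewrite linearP.
Qed.

Lemma is_submod_ker : is_submod [set x | f x = 0].
Proof. exact: is_submod_preimage (@is_submod0 Y). Qed.

Lemma linear_injP : (forall x, f x = 0 -> x = 0) -> injective f.
Proof.
by move=> f0 x y fxy; apply/eqP; rewrite -subr_eq0; apply/eqP/f0;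
  rewrite linearB fxy subrr.
Qed.

End Maps.

(** * Length of an interval of submodules *)

(** The factor [T / B] has length at most [n].  Working with intervals of
    submodules avoids factor modules, and the recursion on [n] avoids
    composition series. *)
Fixpoint len_le (M : lmodType A) (B T : set M) (n : nat) : Prop :=
  if n is n'.+1 then
    forall V, is_submod V -> B `<=` V -> V `<=` T -> ~ T `<=` V -> len_le B V n'
  else T `<=` B.

Section Length.
Variable M : lmodType A.
Implicit Types B C T V W : set M.

Lemma len_leS B T n : len_le B T n -> len_le B T n.+1.
Proof.
elim: n T => [|n IHn] T TB V sV BV VT TV; last exact/IHn/TB.
by case: TV; apply: subset_trans BV.
Qed.

Lemma len_leW B T n m : (n <= m)%N -> len_le B T n -> len_le B T m.
Proof.
move=> /subnK <-; elim: (_ - _)%N => // k IHk /IHk.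
by rewrite addSn; apply: len_leS.
Qed.

Lemma len_le_refl B T n : T `<=` B -> len_le B T n.
Proof. by move=> TB; apply: (len_leW (leq0n n)). Qed.

Lemma len_le_sub B B' T T' n :
  B `<=` B' -> T' `<=` T -> len_le B T n -> len_le B' T' n.
Proof.
move=> BB'; elim: n T T' => [|n IHn] T T' TT' /= lenT.
  exact: subset_trans TT' (subset_trans lenT BB').
move=> V sV B'V VT' T'V.
apply: (IHn V) => //; apply: lenT => //.
- exact: subset_trans B'V.
- exact: subset_trans TT'.
- by move=> TV; apply: T'V; apply: subset_trans TV.
Qed.

(** Going up from the bottom of an interval uses up length just as going down
    from the top does, by which the length is defined. *)
Lemma len_le_up B W T n :
  is_submod W -> B `<=` W -> W `<=` T -> ~ W `<=` B ->
  len_le B T n.+1 -> len_le W T n.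
Proof.
move=> sW BW + WB; elim: n T => [|n IHn] T WT lenT /=.
  by apply: contrapT => TW; apply: WB; apply: lenT.
move=> V sV WV VT TV; apply: IHn => //.
by apply: lenT => //; apply: subset_trans WV.
Qed.

(** A strict chain in the large interval is strict in the meet with [C] or in the
    join with [C] at each step, by the modular law. *)
Lemma len_le_trans B C T a b :
  is_submod C -> is_submod T -> B `<=` C -> C `<=` T ->
  len_le B C a -> len_le C T b -> len_le B T (a + b).
Proof.
move=> sC sT BC CT lenC lenT.
have {lenC} : len_le B (T `&` C) a by apply: len_le_sub lenC.
have {lenT} : len_le C (msum T C) b by apply: len_le_sub lenT => //; apply: msum_sub.
have {CT} := subset_trans BC CT.
move En: (a + b)%N => n.
elim: n a b T sT En => [|n IHn] a b T sT En BT lenT lenC.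
  have [a0 b0] : a = 0%N /\ b = 0%N by lia.
  move: lenT lenC; rewrite a0 b0 /= => TC TCB x Tx.
  by apply: TCB; split=> //; apply/TC/sub_msuml.
move=> V sV BV VT TV.
have [TCV|TCV] := pselect (T `&` C `<=` V); last first.
  case: a En lenC => [|a] En lenC.
    by case: TCV; apply: subset_trans BV.
  case: En => En; apply: (IHn a b) => //.
    by apply: len_le_sub lenT => // x [v [c [/VT Tv Cc ->]]]; exists v, c.
  apply: lenC => //.
  - exact: is_submodI.
  - by move=> x Bx; split; [apply: BV|apply: BC].
  - by move=> x [/VT].
  - by move=> sub; apply: TCV => x /sub[].
case: b En lenT => [|b] En lenT.
  case: TV => x Tx; apply: TCV; split=> //.
  by apply/lenT/sub_msuml.
have {}En : (a + b)%N = n by lia.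
apply: (IHn a b) => //; last first.
  by apply: len_le_sub lenC => // x [/VT].
apply: lenT.
- exact: is_submod_sum.
- exact: sub_msumr.
- by move=> x [v [c [/VT Tv Cc ->]]]; exists v, c.
- move=> sub; apply: TV => x Tx.
  have [v [c [Vv Cc xE]]] := sub _ (sub_msuml sC Tx).
  have Vc : V c.
    apply: TCV; split=> //; have -> : c = x - v by rewrite xE addrAC subrr add0r.
    by apply: is_submodB => //; apply: VT.
  by rewrite xE; apply: is_submodD.
Qed.

(** The noetherian property, for ascending unions. *)
Lemma len_le_union B T n (P : nat -> set M) :
  (forall i, is_submod (P i)) -> (forall i, P i `<=` P i.+1) ->
  B `<=` P 0%N -> (forall i, P i `<=` T) -> (forall x, T x -> exists i, P i x) ->
  len_le B T n -> exists i, T `<=` P i.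
Proof.
move=> sP incP + PT TP; have {}incP i j : (i <= j)%N -> P i `<=` P j.
  move=> /subnK <-; elim: (_ - _)%N => // k IHk x /IHk; exact: incP.
elim: n B 0%N => [|n IHn] B k BP lenT; first by exists k; apply: subset_trans BP.
have [TB|/existsNP[t /not_implyP[Tt Bt]]] := pselect (T `<=` B).
  by exists k; apply: subset_trans BP.
have [i Pit] := TP t Tt.
apply: (IHn (P (maxn i k)) (maxn i k)) => //.
apply: len_le_up lenT => //.
- exact: subset_trans (incP _ _ (leq_maxr _ _)).
- by move=> /(_ t) PB; apply/Bt/PB/(incP i) => //; apply: leq_maxl.
Qed.

Lemma len_le_atom B T n : is_submod T -> B `<=` T -> ~ T `<=` B ->
  len_le B T n ->
  exists V, [/\ is_submod V, B `<=` V, V `<=` T, ~ V `<=` B &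
    forall W, is_submod W -> B `<=` W -> W `<=` V -> ~ W `<=` B -> V `<=` W].
Proof.
elim: n T => // n IHn T sT BT TB lenT.
have [minT|] := pselect (forall W, is_submod W -> B `<=` W -> W `<=` T ->
    ~ W `<=` B -> T `<=` W).
  by exists T; split.
move=> /existsNP[W /not_implyP[sW /not_implyP[BW /not_implyP[WT
  /not_implyP[WB TW]]]]].
have [V [sV BV VW VB minV]] := IHn W sW BW WB (lenT W sW BW WT TW).
by exists V; split=> //; apply: subset_trans WT.
Qed.

End Length.

Section LengthMaps.
Variables (X Y : lmodType A) (f : {linear X -> Y}).

Lemma len_le_codomain (B T : set X) (B' T' : set Y) n :
  is_submod T -> is_submod B' -> B `<=` T -> (forall x, B x -> B' (f x)) ->
  (forall y, T' y -> exists b x, [/\ B' b, T x & y = b + f x]) ->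
  len_le B T n -> len_le B' T' n.
Proof.
move=> sT sB' + fB; elim: n T T' sT => [|n IHn] T T' sT BT fT lenT.
  move=> y /fT[b [x [B'b /lenT/fB B'fx ->]]]; exact: is_submodD.
move=> V sV BV VT TV.
have sT' : is_submod (T `&` f @^-1` V).
  by apply: is_submodI => //; apply: is_submod_preimage.
have BT' : B `<=` T `&` f @^-1` V by move=> x Bx; split; [apply: BT|apply/BV/fB].
apply: (IHn (T `&` f @^-1` V)) => //.
- move=> y Vy; have [b [x [B'b Tx yE]]] := fT _ (VT _ Vy).
  exists b, x; split=> //; split=> //=.
  have -> : f x = y - b by rewrite yE addrAC subrr add0r.
  by apply: is_submodB => //; apply: BV.
- apply: lenT => // sub; apply: TV => y /fT[b [x [B'b /sub[_ Vfx] ->]]].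
  by apply: is_submodD => //; apply: BV.
Qed.

Lemma len_le_domain (B T : set X) (B' T' : set Y) n :
  is_submod T -> is_submod B' -> is_submod T' -> B' `<=` T' ->
  (forall x, T x -> T' (f x)) -> (forall x, T x -> B' (f x) -> B x) ->
  len_le B' T' n -> len_le B T n.
Proof.
move=> sT sB'; elim: n T T' sT => [|n IHn] T T' sT sT' BT' fT fB lenT.
  by move=> x Tx; apply: fB => //; apply/lenT/fT.
move=> V sV BV VT TV.
have sW : is_submod (msum B' (f @` V)).
  by apply: is_submod_sum => //; apply: is_submod_image.
apply: (IHn V (msum B' (f @` V))) => //.
- by apply: sub_msuml; apply: is_submod_image.
- by move=> x Vx; apply: sub_msumr => //; exists x.
- by move=> x /VT; apply: fB.
- apply: lenT => //.
  + by apply: sub_msuml; apply: is_submod_image.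
  + by apply: msum_sub => // _ [x /VT/fT T'fx <-].
  + move=> sub; apply: TV => x Tx; have [b [_ [B'b [v Vv <-] fxE]]] := sub _ (fT _ Tx).
    rewrite -[x](subrK v); apply: is_submodD => //; apply/BV/fB.
      by apply: is_submodB => //; apply: VT.
    by rewrite linearB fxE addrK.
Qed.

End LengthMaps.

End Submodules.

(** * Products, images and isomorphism classes *)

Section Modules.
Variable A : nzRingType.
Implicit Types X Y Z E : lmodType A.

Definition sub_incl X (U : submodClosed X) : {linear submod U -> X} :=
  @to_linear A (submod U) X val (fun a x y => erefl).

Lemma sub_incl_inj X (U : submodClosed X) : injective (sub_incl U).
Proof. exact: val_inj. Qed.

Lemma sub_incl_in X (U : submodClosed X) x : sub_incl U x \in U.
Proof. exact: valP. Qed.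

Lemma corestr_linear X Y (U : submodClosed Y) (f : {linear X -> Y})
  (h : forall x, f x \in U) : linear (fun x => Sub (f x) (h x) : submod U).
Proof. by move=> a x y; apply: val_inj; rewrite /= linearP. Qed.

Definition corestr X Y (U : submodClosed Y) (f : {linear X -> Y})
  (h : forall x, f x \in U) : {linear X -> submod U} :=
  to_linear (corestr_linear h).

Definition pfst X Y : {linear (X * Y)%type -> X} :=
  @to_linear A (X * Y)%type X fst (fun a x y => erefl).
Definition psnd X Y : {linear (X * Y)%type -> Y} :=
  @to_linear A (X * Y)%type Y snd (fun a x y => erefl).

Fact pairing_linear Z X Y (f : {linear Z -> X}) (g : {linear Z -> Y}) :
  linear (fun z => (f z, g z) : (X * Y)%type).
Proof. by move=> a x y; rewrite !linearP. Qed.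

Definition pairing Z X Y (f : {linear Z -> X}) (g : {linear Z -> Y}) :
  {linear Z -> (X * Y)%type} := to_linear (pairing_linear f g).

Definition image_submod X Y (f : {linear X -> Y}) : submodClosed Y :=
  of_set (is_submod_image f (is_submodT X)).

Fact image_map_subproof X Y (f : {linear X -> Y}) x : f x \in image_submod f.
Proof. by apply/asboolP; exists x. Qed.

Definition image_map X Y (f : {linear X -> Y}) :
  {linear X -> submod (image_submod f)} := corestr (image_map_subproof f).

Lemma image_map_surj X Y (f : {linear X -> Y}) y : exists x, image_map f x = y.
Proof. by case: y => y yP; have /asboolP[x _ fx] := yP; exists x; apply: val_inj. Qed.

Lemma iso_inj_surj X Y (f : {linear X -> Y}) :
  injective f -> (forall y, exists x, f x = y) -> isomorphic X Y.
Proof.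
move=> fI /choice[g gP]; exists f; exists g => // x; exact/fI/gP.
Qed.

Lemma iso_sym X Y : isomorphic X Y -> isomorphic Y X.
Proof.
move=> [f [g fK gK]]; exists (to_linear (can2_linear fK gK)).
by exists f.
Qed.

Lemma iso_trans X Y Z : isomorphic X Y -> isomorphic Y Z -> isomorphic X Z.
Proof.
move=> [f bf] [g bg]; exists (g \o f : {linear X -> Z}); exact: bij_comp.
Qed.

Lemma iso_image X Y (f : {linear X -> Y}) :
  injective f -> isomorphic X (submod (image_submod f)).
Proof.
move=> fI; apply: (@iso_inj_surj _ _ (image_map f) _ (@image_map_surj _ _ f)).
by move=> x y /(congr1 val); apply: fI.
Qed.

Lemma zero_iso X Y : isomorphic X Y -> zero_module X -> zero_module Y.
Proof. by move=> [f [g _ gK]] X0 y; rewrite -[y]gK (X0 (g y)) linear0. Qed.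

Lemma indecomposable_iso X Y :
  isomorphic X Y -> indecomposable X -> indecomposable Y.
Proof.
move=> XY [nzX iX]; split; first by move=> /(zero_iso (iso_sym XY)).
by move=> V W YVW; apply: iX; apply: iso_trans YVW.
Qed.

Lemma not_indecomposable X : ~ indecomposable X ->
  zero_module X \/ exists V W : lmodType A,
    [/\ isomorphic X (V * W)%type, ~ zero_module V & ~ zero_module W].
Proof.
move=> nX; have [|nzX] := pselect (zero_module X); [by left|right].
apply: contrapT => none; apply: nX; split=> // V W XVW.
have [|nzV] := pselect (zero_module V); [by left|right].
by apply: contrapT => nzW; apply: none; exists V, W.
Qed.

(** A nonzero retract of an indecomposable module is the whole module, the
    kernel of the retraction being a complement. *)
Lemma retract_indecomposable E Y (i : {linear E -> Y}) (q : {linear Y -> E}) :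
  cancel i q -> indecomposable Y -> ~ zero_module E -> isomorphic Y E.
Proof.
move=> iK [_ iY] nzE; pose K := of_set (is_submod_ker q).
pose k : {linear Y -> Y} := idfun \- (i \o q).
have kE y : k y = y - i (q y) by [].
have kK y : k y \in K.
  by apply/asboolP; rewrite /= linearB /= iK subrr.
have : isomorphic Y (E * submod K)%type.
  apply: (@iso_inj_surj _ _ (pairing q (corestr kK))).
    apply: linear_injP => y E0; have qy : q y = 0 := congr1 fst E0.
    by have := congr1 (fun p => val p.2) E0; rewrite /= qy linear0 subr0.
  move=> [e [v vK]]; have /asboolP /= qv := vK.
  exists (i e + v); congr pair; first by rewrite /= linearD iK qv addr0.
  by apply: val_inj; rewrite /= linearD iK qv addr0 addrAC subrr add0r.
move=> /iY[/nzE//|K0]; exists q; exists i => // y.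
apply/eqP; rewrite eq_sym -subr_eq0; apply/eqP; rewrite -kE.
exact: (congr1 val (K0 (corestr kK y))).
Qed.

Definition lenle X (n : nat) : Prop := len_le [set 0 : X] setT n.

Lemma lenle0 X : lenle X 0 <-> zero_module X.
Proof. by split=> [lenX x|X0 x _]; [apply: lenX|apply: X0]. Qed.

Lemma lenleW X n m : (n <= m)%N -> lenle X n -> lenle X m.
Proof. exact: len_leW. Qed.

Lemma lenle_inj X Y (f : {linear X -> Y}) n :
  injective f -> lenle Y n -> lenle X n.
Proof.
move=> fI; apply: (len_le_domain (f := f)) => //; first exact: is_submod0.
by move=> x _ /= fx0; apply: fI; rewrite linear0.
Qed.

Lemma lenle_iso X Y n : isomorphic X Y -> lenle Y n -> lenle X n.
Proof. by move=> [f /bij_inj fI]; apply: lenle_inj fI. Qed.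

Lemma lenle_inj_strict X Y (f : {linear X -> Y}) n :
  injective f -> ~ (forall y, exists x, f x = y) -> lenle Y n.+1 -> lenle X n.
Proof.
move=> fI fS lenY.
apply: (len_le_domain (f := f) (B' := [set 0]) (T' := range f)) => //.
- exact: is_submod0.
- exact: is_submod_image.
- by move=> _ ->; exists 0; rewrite ?linear0.
- by move=> x _ /= fx0; apply: fI; rewrite linear0.
- apply: lenY => //; first exact: is_submod_image.
    by move=> _ ->; exists 0; rewrite ?linear0.
  by move=> sub; apply: fS => y; have [//|x _ <-] := sub y; exists x.
Qed.

Lemma lenle_image_strict X Y (f : {linear X -> Y}) n :
  ~ injective f -> lenle X n.+1 -> lenle (submod (image_submod f)) n.
Proof.
move=> fI lenX.
apply: (@len_le_codomain _ _ _ (image_map f) [set x | f x = 0] setT) => //.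
- exact: is_submod0.
- by move=> x /= fx; apply: val_inj.
- by move=> y _; have [x <-] := image_map_surj y; exists 0, x; rewrite add0r.
- apply: (@len_le_up _ _ [set 0] [set x | f x = 0] setT) => //.
  + exact: is_submod_ker.
  + by move=> _ ->; rewrite /= linear0.
  + by move=> sub; apply: fI; apply: linear_injP => x /sub.
Qed.

Lemma lenle_prod X Y a b : lenle X a -> lenle Y b -> lenle (X * Y)%type (a + b).
Proof.
move=> lenX lenY.
have sK : is_submod [set p : (X * Y)%type | psnd X Y p = 0] by exact: is_submod_ker.
apply: (@len_le_trans _ _ _ [set p : (X * Y)%type | psnd X Y p = 0]) => //.
- by move=> _ ->.
- apply: (len_le_domain (f := pfst X Y)) lenX => //; first exact: is_submod0.
  by move=> [x y] y0 x0; congr pair.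
- by apply: (len_le_domain (f := psnd X Y)) lenY => //; apply: is_submod0.
Qed.

Lemma has_length_lenle X d : has_length X d -> lenle X d.
Proof.
move=> [U [U0 Ud Ucov]].
have sU i : is_submod [set x : X | x \in U i].
  by split=> [|a x y /=]; [exact: rpred0|move=> *; rewrite /= rpredD ?rpredZ].
suff len_i i : (i <= d)%N -> len_le [set 0 : X] [set x | x \in U i] i.
  by apply: len_le_sub (len_i d (leqnn d)) => // x _; apply: Ud.
elim: i => [_|i IHi lt_id]; first by move=> x /=; rewrite U0 => /eqP.
have [[sub_i nsub_i] cov_i] := Ucov i lt_id.
rewrite -addn1; apply: (@len_le_trans _ _ _ [set x | x \in U i]) => //.
- by move=> _ ->; apply: rpred0.
- by rewrite addn1; exact: sub_i.
- exact/IHi/ltnW.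
rewrite addn1.
move=> V sV UV VU UsV x Vx.
have VE y : (y \in of_set sV) = `[< V y >] by [].
have [y||EV|EV] := cov_i (of_set sV).
- by rewrite VE => Uy; apply/asboolP/UV.
- by move=> y; rewrite VE => /asboolP/VU.
- by rewrite /= -EV VE; apply/asboolP.
- by case: UsV => y /=; rewrite -EV VE => /asboolP.
Qed.

Lemma finite_length_lenle X : finite_length X -> exists n, lenle X n.
Proof. by move=> [d /has_length_lenle]; exists d. Qed.

Lemma finitely_many_fin (P : lmodType A -> Prop) (I : finType)
    (Y : I -> lmodType A) :
  (forall X, P X -> exists i, isomorphic X (Y i)) -> finitely_many_iso_classes P.
Proof.
move=> PY; exists #|I|, (Y \o enum_val) => X /PY[i XY].
by exists (enum_rank i); rewrite /= enum_rankK.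
Qed.

Lemma finitely_many_sub (P Q : lmodType A -> Prop) :
  (forall X, P X -> Q X) -> finitely_many_iso_classes Q ->
  finitely_many_iso_classes P.
Proof. by move=> PQ [n [Y QY]]; exists n, Y => X /PQ/QY. Qed.

Lemma finitely_many_zero : finitely_many_iso_classes (fun X => zero_module X).
Proof.
exists 1%N, (fun=> submod (of_set (is_submod0 A^o))) => X X0; exists ord0.
apply: (@iso_inj_surj _ _ \0) => [x y _|y]; first by rewrite (X0 x) (X0 y).
by exists 0; case: y => y yP; apply: val_inj; have /asboolP /= -> := yP.
Qed.

Lemma finitely_many_or (P Q : lmodType A -> Prop) :
  finitely_many_iso_classes P -> finitely_many_iso_classes Q ->
  finitely_many_iso_classes (fun X => P X \/ Q X).
Proof.
move=> [n [Y PY]] [m [Z QZ]].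
apply: (@finitely_many_fin _ ('I_n + 'I_m)%type
  (fun s => match s with inl i => Y i | inr j => Z j end)) => X [/PY[i]|/QZ[j]].
- by exists (inl i).
- by exists (inr j).
Qed.

Lemma finitely_many_iso Y : finitely_many_iso_classes (fun X => isomorphic X Y).
Proof. by exists 1%N, (fun=> Y) => X XY; exists ord0. Qed.

Lemma iso_prod X X' Y Y' : isomorphic X X' -> isomorphic Y Y' ->
  isomorphic (X * Y)%type (X' * Y')%type.
Proof.
move=> [f [f' fK f'K]] [g [g' gK g'K]].
exists (pairing (f \o pfst X Y : {linear _ -> _})
                (g \o psnd X Y : {linear _ -> _})).
exists (fun p => (f' p.1, g' p.2)) => [[x y]|[x y]] /=.
- by rewrite fK gK.
- by congr pair; [apply: f'K|apply: g'K].
Qed.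

Lemma finitely_many_prod (P Q : lmodType A -> Prop) :
  finitely_many_iso_classes P -> finitely_many_iso_classes Q ->
  finitely_many_iso_classes
    (fun X => exists V W : lmodType A, [/\ P V, Q W & isomorphic X (V * W)%type]).
Proof.
move=> [n [Y PY]] [m [Z QZ]].
apply: (@finitely_many_fin _ ('I_n * 'I_m)%type
  (fun p => Y p.1 * Z p.2)%type) => X [V [W [/PY[i VY] /QZ[j WZ] XVW]]].
by exists (i, j); apply: iso_trans XVW (iso_prod VY WZ).
Qed.

Lemma finitely_many_bounded (P : lmodType A -> Prop) :
  finitely_many_iso_classes P -> (forall X, P X -> exists n, lenle X n) ->
  exists n, forall X, P X -> lenle X n.
Proof.
move=> [m [Y PY]] lenP.
have /choice[b bP] (i : 'I_m) :
    exists n, forall X, P X -> isomorphic X (Y i) -> lenle X n.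
  have [[X [PX XY]]|none] := pselect (exists X, P X /\ isomorphic X (Y i)).
    have [n lenX] := lenP X PX; exists n => X' _ X'Y.
    by apply: lenle_iso lenX; apply: iso_trans X'Y (iso_sym XY).
  by exists 0%N => X PX XY; case: none; exists X.
exists (\max_(i < m) b i)%N => X PX; have [i XY] := PY X PX.
by apply: lenleW (bP i X PX XY); apply: leq_bigmax.
Qed.

End Modules.

(** * Subdirectly irreducible objects of a minimal subcategory *)

Section Minimal.
Variable A : nzRingType.
Implicit Types (X Y Z R : lmodType A) (F : lmodType A -> Prop).

Definition embeds X Y : Prop := exists f : {linear X -> Y}, injective f.

Definition cogenerated_by F X : Prop :=
  forall x : X, x <> 0 -> exists2 Y, F Y & exists f : {linear X -> Y}, f x <> 0.

(** The element [z] witnesses that the nonzero kernels of maps from [R] to objects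
    of [C] intersect in a nonzero submodule. *)
Definition subdirectly_irreducible (C : lmodType A -> Prop) R : Prop :=
  C R /\ exists2 z : R, z <> 0 &
    forall Y, C Y -> forall f : {linear R -> Y}, injective f \/ f z = 0.

Lemma embeds_trans X Y Z : embeds X Y -> embeds Y Z -> embeds X Z.
Proof.
move=> [f fI] [g gI]; exists (g \o f : {linear X -> Z}); exact: inj_comp.
Qed.

Lemma embeds_iso X Y : isomorphic X Y -> embeds X Y.
Proof. by move=> [f /bij_inj fI]; exists f. Qed.

Variable C : lmodType A -> Prop.
Hypotheses (subC : subcategory C) (clC : submodule_closed C).

Lemma closed_embeds X Y : embeds X Y -> C Y -> C X.
Proof.
move=> [f fI] CY; apply: (subcat_iso subC (iso_sym (iso_image fI))).
exact: clC.
Qed.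

Lemma closed_image X Y (f : {linear X -> Y}) : C Y -> C (submod (image_submod f)).
Proof. by move=> CY; apply: clC. Qed.

Lemma closed_lenle X : C X -> exists n, lenle X n.
Proof. by move=> /(subcat_length subC)/finite_length_lenle. Qed.

Lemma subcat_cogenerated_by F :
  subcategory (fun X => C X /\ cogenerated_by F X).
Proof.
split.
- by move=> X [/(subcat_length subC)].
- by move=> X X0; split; [exact: (subcat_zero subC)|move=> x; rewrite (X0 x)].
- move=> X Y [CX FX] [CY FY]; split; first exact: (subcat_sum subC).
  move=> [x y] xy0; have [x0|nx0] := pselect (x = 0).
    have [|Z FZ [f fy]] := FY y; first by move=> y0; apply: xy0; rewrite x0 y0.
    by exists Z => //; exists (f \o psnd X Y : {linear _ -> _}).
  have [Z FZ [f fx]] := FX x nx0.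
  by exists Z => //; exists (f \o pfst X Y : {linear _ -> _}).
- move=> X Y XY [CX FX]; split; first exact: (subcat_iso subC XY CX).
  have [g gI] := embeds_iso (iso_sym XY).
  move=> y y0; have [|Z FZ [f fy]] := FX (g y).
    by move=> gy0; apply: y0; apply: gI; rewrite linear0.
  by exists Z => //; exists (f \o g : {linear _ -> _}).
- move=> X Y [CXY FXY]; split; first exact: (subcat_summand subC CXY).
  move=> x x0; have [|Z FZ [f fx]] := FXY (x, 0); first by move=> [].
  exists Z => //.
  by exists (f \o pairing (idfun : {linear X -> X}) (\0 : {linear X -> Y})
               : {linear _ -> _}).
Qed.

Lemma closed_cogenerated_by F :
  submodule_closed (fun X => C X /\ cogenerated_by F X).
Proof.
move=> X [CX FX] U; split; first exact: clC.
move=> u u0; have [|Z FZ [f fu]] := FX (sub_incl U u).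
  by move=> E; apply: u0; apply: (@sub_incl_inj _ _ U); rewrite linear0.
by exists Z => //; exists (f \o sub_incl U : {linear _ -> _}).
Qed.

Lemma subdirectly_irreducible_embeds F R : (forall Y, F Y -> C Y) ->
  subdirectly_irreducible C R -> cogenerated_by F R ->
  exists2 Y, F Y & embeds R Y.
Proof.
move=> FC [_ [z z0 zP]] /(_ z z0)[Y FY [f fz]]; exists Y => //; exists f.
by have [] := zP Y (FC Y FY) f.
Qed.

Lemma subdirectly_irreducible_indecomposable R :
  subdirectly_irreducible C R -> indecomposable R.
Proof.
move=> [CR [z z0 zP]]; split; first by move=> /(_ z).
move=> X Y [f bf]; have [g fK gK] := bf.
have CXY : C (X * Y)%type by apply: (subcat_iso subC _ CR); exists f.
have CX := subcat_summand subC CXY.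
have CY : C Y.
  apply: closed_embeds CXY; exists (pairing (\0 : {linear Y -> X}) idfun).
  by move=> y y' [].
have [fz1|nfz1] := pselect ((f z).1 = 0); last first.
  have [pI|/nfz1//] := zP X CX (pfst X Y \o f : {linear _ -> _}).
  right=> y; have : g (0, y) = g 0 by apply: pI; rewrite /= !gK.
  by move=> /(can_inj gK)[].
have [pI|fz2] := zP Y CY (psnd X Y \o f : {linear _ -> _}).
  left=> x; have : g (x, 0) = g 0 by apply: pI; rewrite /= !gK.
  by move=> /(can_inj gK)[].
case: z0; apply: (can_inj fK); rewrite linear0.
by rewrite [LHS]surjective_pairing; congr pair.
Qed.

(** A module that is not subdirectly irreducible is cogenerated by its proper
    factor modules in [C], which are shorter. *)
Lemma cogenerated_by_subdirectly_irreducible X :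
  C X -> cogenerated_by (subdirectly_irreducible C) X.
Proof.
move=> CX; have [n lenX] := closed_lenle CX.
elim: n X CX lenX => [|n IHn] X CX lenX x x0.
  by case: x0; apply: (lenle0 X).1.
have [irrX|nirrX] := pselect (subdirectly_irreducible C X).
  by exists X => //; exists idfun.
have [Y [CY [f [fI fx]]]] : exists Y, C Y /\
    exists f : {linear X -> Y}, ~ injective f /\ f x <> 0.
  apply: contrapT => none; apply: nirrX; split=> //; exists x => // Y CY f.
  apply: contrapT => /not_orP[fI fx]; apply: none.
  by exists Y; split=> //; exists f.
have [|Z irrZ [g gfx]] := IHn _ (closed_image f CY) (lenle_image_strict fI lenX)
    (image_map f x).
  by move=> /(congr1 (sub_incl _)).
by exists Z => //; exists (g \o image_map f : {linear _ -> _}).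
Qed.

Hypotheses (infC : infinite_subcat C) (minC : ~ exists D,
  [/\ subcategory D, proper_subcat D C, infinite_subcat D & submodule_closed D]).

(** The objects of [C] cogenerated by the family form an infinite
    submodule-closed subcategory. *)
Lemma infinite_family_cogenerates F :
  (forall Y, F Y -> C Y /\ indecomposable Y) -> ~ finitely_many_iso_classes F ->
  forall X, C X -> cogenerated_by F X.
Proof.
move=> FC infF.
pose D X := C X /\ cogenerated_by F X.
suff CD X : C X -> D X by move=> X /CD[].
apply: contrapT => nCD; apply: minC; exists D; split.
- exact: subcat_cogenerated_by.
- split; first by move=> Y [].
  by move=> CD; apply: nCD; apply: CD.
- move=> finD; apply: infF; apply: finitely_many_sub finD => Y FY.
  have [CY iY] := FC Y FY; split=> //; split=> // y y0.
  by exists Y => //; exists idfun.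
- exact: closed_cogenerated_by.
Qed.

Lemma subdirectly_irreducible_embeds_infinite F R :
  subdirectly_irreducible C R ->
  (forall Y, F Y -> C Y /\ indecomposable Y) -> ~ finitely_many_iso_classes F ->
  exists2 Y, F Y & embeds R Y.
Proof.
move=> irrR FC infF; apply: subdirectly_irreducible_embeds => //.
  by move=> Y /FC[].
by apply: infinite_family_cogenerates => //; case: irrR.
Qed.

Lemma finitely_many_not_containing R : subdirectly_irreducible C R ->
  finitely_many_iso_classes (fun Y => (C Y /\ indecomposable Y) /\ ~ embeds R Y).
Proof.
move=> irrR; apply: contrapT => inf.
have [|Y [_ //]] := subdirectly_irreducible_embeds_infinite irrR _ inf.
by move=> Y [].
Qed.

(** Were there only finitely many, a longest one [R] would be a direct summand
    of every indecomposable [Y] containing it: [Y] is cogenerated by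
    subdirectly irreducible modules, so [R] embeds into one of them through
    [Y], and that embedding is bijective. *)
Lemma infinitely_many_subdirectly_irreducible :
  ~ finitely_many_iso_classes (subdirectly_irreducible C).
Proof.
move=> fin; have [b lenb] : exists n, forall X, subdirectly_irreducible C X -> lenle X n.
  by apply: finitely_many_bounded fin _ => X [/closed_lenle].
have [R irrR maxR] : exists2 R, subdirectly_irreducible C R &
    forall R', subdirectly_irreducible C R' -> forall f : {linear R -> R'},
    injective f -> forall y, exists x, f x = y.
  elim: b lenb => [|b IHb] lenb.
    case: infC; apply: (finitely_many_sub _ (finitely_many_zero A)).
    move=> X [CX _] x; apply: contrapT => x0.
    have [Y irrY [f fx]] := cogenerated_by_subdirectly_irreducible CX x0.
    by apply: fx; apply: (lenle0 Y).1 (lenb Y irrY) _.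
  have [/IHb //|] := pselect (forall X, subdirectly_irreducible C X -> lenle X b).
  move=> /existsNP[R /not_implyP[irrR lenR]]; exists R => // R' irrR' f fI.
  apply: contrapT => fS; apply: lenR.
  by apply: lenle_inj_strict fI fS (lenb R' irrR').
apply: infC; rewrite /finite_subcat; apply: finitely_many_sub (finitely_many_or
  (finitely_many_not_containing irrR) (finitely_many_iso R)) => Y [CY iY].
have [[f fI]|nRY] := pselect (embeds R Y); [right|by left].
have [CR [z z0 zP]] := irrR.
have [|R' irrR' [g gfz]] :=
  cogenerated_by_subdirectly_irreducible CY (x := f z).
  by rewrite -(linear0 f) => /fI.
have [gfI|//] := zP R' irrR'.1 (g \o f : {linear _ -> _}).
have gfS := maxR R' irrR' _ gfI.
have [gf1 gf1K gfK1] : bijective (g \o f).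
  by have [k kP] := choice gfS; exists k => // x; apply: gfI; rewrite kP.
pose q : {linear R' -> R} :=
  to_linear (can2_linear (f := (g \o f : {linear _ -> _})) gf1K gfK1).
apply: (retract_indecomposable (i := f) (q := q \o g : {linear _ -> _})) => //.
Qed.

(** Among infinitely many such modules one of the largest length would embed
    into another one, of at most the same length. *)
Lemma finitely_many_subdirectly_irreducible_lenle d :
  finitely_many_iso_classes (fun R => subdirectly_irreducible C R /\ lenle R d).
Proof.
elim: d => [|d IHd].
  apply: (@finitely_many_sub _ _ (fun=> False)); last by exists 0%N, (fun=> A^o).
  by move=> X [[_ [z z0 _]] /lenle0 X0]; apply/z0/X0.
apply: contrapT => inf.
have [[R [[irrR lenR] nlenR]]|none] := pselect (exists R,
    (subdirectly_irreducible C R /\ lenle R d.+1) /\ ~ lenle R d); last first.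
  apply: inf; apply: finitely_many_sub IHd => X [irrX lenX]; split=> //.
  by apply: contrapT => nlenX; apply: none; exists X.
have [||Y [[irrY lenY] nRY] [f fI]] := subdirectly_irreducible_embeds_infinite
  (F := fun Y => (subdirectly_irreducible C Y /\ lenle Y d.+1) /\ ~ isomorphic Y R) irrR.
- move=> Y [[irrY _] _]; split; first by case: irrY.
  exact: subdirectly_irreducible_indecomposable.
- move=> fin; apply: inf.
  apply: finitely_many_sub (finitely_many_or fin (finitely_many_iso R)) => X PX.
  by have [|] := pselect (isomorphic X R); [right|left].
- apply: nlenR; apply: (lenle_inj_strict fI _ lenY) => fS.
  exact/nRY/iso_sym/(iso_inj_surj fI).
Qed.

(** If infinitely many indecomposables had length [d.+1], each of them would be
    cogenerated by the others, hence by modules of length at most [d]; these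
    would then cogenerate [C] and bound the subdirectly irreducible modules. *)
Lemma finitely_many_indecomposable_lenle d :
  finitely_many_iso_classes (fun X => (C X /\ indecomposable X) /\ lenle X d).
Proof.
elim: d => [|d IHd].
  apply: (@finitely_many_sub _ _ (fun=> False)); last by exists 0%N, (fun=> A^o).
  by move=> X [[_ [nzX _]] /lenle0].
apply: contrapT => inf.
pose F X := ((C X /\ indecomposable X) /\ lenle X d.+1) /\ ~ lenle X d.
have infF : ~ finitely_many_iso_classes F.
  move=> finF; apply: inf; apply: finitely_many_sub (finitely_many_or finF IHd).
  by move=> X [CX lenX]; have [|] := pselect (lenle X d); [right|left].
have cogF X : F X -> cogenerated_by (fun Y => C Y /\ lenle Y d) X.
  move=> FX x x0; have [[[CX iX] lenX] nlenX] := FX.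
  have [||Y [FY nXY] [f fx]] := @infinite_family_cogenerates
    (fun Y => F Y /\ ~ isomorphic Y X) _ _ X CX x x0.
  - by move=> Y [[[]]].
  - move=> fin; apply: infF.
    apply: finitely_many_sub (finitely_many_or fin (finitely_many_iso X)) => Y PY.
    by have [|] := pselect (isomorphic Y X); [right|left].
  have [[[CY _] lenY] _] := FY.
  have fI : ~ injective f.
    move=> fI; apply: nlenX; apply: (lenle_inj_strict fI _ lenY) => fS.
    exact/nXY/iso_sym/(iso_inj_surj fI).
  exists (submod (image_submod f)).
    by split; [apply: closed_image|apply: lenle_image_strict].
  by exists (image_map f) => /(congr1 (sub_incl _)).
have cogC X : C X -> cogenerated_by (fun Y => C Y /\ lenle Y d) X.
  move=> CX x x0; have [||Y FY [f fx]] := @infinite_family_cogenerates F _ _ X CX x x0 => //.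
    by move=> Y [[]].
  have [Z FZ [g gfx]] := cogF Y FY _ fx.
  by exists Z => //; exists (g \o f : {linear _ -> _}).
apply: infinitely_many_subdirectly_irreducible.
apply: finitely_many_sub (finitely_many_subdirectly_irreducible_lenle d) => R irrR.
split=> //; have [|Y [CY lenY] [f fI]] := subdirectly_irreducible_embeds _ irrR (cogC R irrR.1).
  by move=> Y [].
exact: lenle_inj fI lenY.
Qed.

Lemma finitely_many_lenle d : finitely_many_iso_classes (fun X => C X /\ lenle X d).
Proof.
have fin0 := finitely_many_zero A.
elim: d => [|d IHd].
  by apply: finitely_many_sub fin0 => X [_ /lenle0].
apply: finitely_many_sub (finitely_many_or (finitely_many_or fin0
  (finitely_many_indecomposable_lenle d.+1)) (finitely_many_prod IHd IHd)) => X [CX lenX].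
have [iX|/not_indecomposable] := pselect (indecomposable X); first by left; right.
move=> [X0|[V [W [[f bf] nzV nzW]]]]; [by left; left|right].
have CVW : C (V * W)%type by apply: (subcat_iso subC _ CX); exists f.
have lenVW : lenle (V * W)%type d.+1 by apply: lenle_iso lenX; apply: iso_sym; exists f.
exists V, W; split; last by exists f.
- split; first exact: (subcat_summand subC CVW).
  apply: (lenle_inj_strict (f := pairing idfun (\0 : {linear V -> W}))) lenVW.
    by move=> x y [].
  by move=> fS; apply: nzW => w; have [v []] := fS (0, w).
- split.
    apply: closed_embeds CVW; exists (pairing (\0 : {linear W -> V}) idfun).
    by move=> x y [].
  apply: (lenle_inj_strict (f := pairing (\0 : {linear W -> V}) idfun)) lenVW.
    by move=> x y [].
  by move=> fS; apply: nzV => v; have [w []] := fS (v, 0).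
Qed.

End Minimal.

(** * Factor modules and unions of chains *)

Section QuotientModule.
Variables (A : nzRingType) (M : lmodType A) (V : set M) (sV : is_submod V).
Local Open Scope quotient_scope.

Definition quot_module := Quotient.quot (set_submod_pred sV).

HB.instance Definition _ := GRing.Zmodule.on quot_module.
HB.instance Definition _ := EqQuotient.on quot_module.

Lemma quot_module_eq x y : \pi_quot_module x = \pi_quot_module y <-> V (x - y).
Proof.
split=> [/eqP|Vxy]; last apply/eqP; rewrite -Quotient.idealrBE.
- by move=> /asboolP.
- exact/asboolP.
Qed.

Definition quot_scale (a : A) (p : quot_module) : quot_module :=
  \pi_quot_module (a *: repr p).

Lemma quot_scale_pi a x :
  quot_scale a (\pi_quot_module x) = \pi_quot_module (a *: x).
Proof.
apply/quot_module_eq; rewrite -scalerBr; apply: is_submodZ => //.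
by apply/quot_module_eq; rewrite reprK.
Qed.

Lemma quot_add_pi x y :
  \pi_quot_module x + \pi_quot_module y = \pi_quot_module (x + y).
Proof. by rewrite -[LHS]Quotient.pi_add. Qed.

Fact quot_scalerA a b p :
  quot_scale a (quot_scale b p) = quot_scale (a * b) p.
Proof.
by rewrite -[p]reprK (quot_scale_pi b) (quot_scale_pi a) quot_scale_pi scalerA.
Qed.

Fact quot_scale1r : left_id 1 quot_scale.
Proof. by move=> p; rewrite -[p]reprK !quot_scale_pi scale1r. Qed.

Fact quot_scalerDr : right_distributive quot_scale +%R.
Proof.
move=> a p q; rewrite -[p]reprK -[q]reprK.
by rewrite quot_add_pi !quot_scale_pi quot_add_pi scalerDr.
Qed.

Fact quot_scalerDl p : {morph quot_scale^~ p : a b / a + b}.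
Proof.
by move=> a b; rewrite -[p]reprK !quot_scale_pi quot_add_pi scalerDl.
Qed.

HB.instance Definition _ := GRing.Zmodule_isLmodule.Build A quot_module
  quot_scalerA quot_scale1r quot_scalerDr quot_scalerDl.

Fact quot_map_linear : linear (fun x => \pi_quot_module x).
Proof. by move=> a x y; rewrite -quot_add_pi -quot_scale_pi. Qed.

Definition quot_map : {linear M -> quot_module} := to_linear quot_map_linear.

End QuotientModule.

Section SequenceModule.
Variables (A : nzRingType) (X : nat -> lmodType A).

Definition seq_module := forall i, X i.

HB.instance Definition _ := gen_eqMixin seq_module.
HB.instance Definition _ := gen_choiceMixin seq_module.

Implicit Types v w : seq_module.

Fact seq_addA : associative (fun v w : seq_module => (fun i => v i + w i) : seq_module).
Proof. by move=> u v w; apply: functional_extensionality_dep => i; apply: addrA. Qed.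
Fact seq_addC : commutative (fun v w : seq_module => (fun i => v i + w i) : seq_module).
Proof. by move=> v w; apply: functional_extensionality_dep => i; apply: addrC. Qed.
Fact seq_add0 : left_id ((fun i => 0) : seq_module)
  (fun v w : seq_module => (fun i => v i + w i) : seq_module).
Proof. by move=> v; apply: functional_extensionality_dep => i; apply: add0r. Qed.
Fact seq_addN : left_inverse ((fun i => 0) : seq_module)
  (fun v => (fun i => - v i) : seq_module)
  (fun v w : seq_module => (fun i => v i + w i) : seq_module).
Proof. by move=> v; apply: functional_extensionality_dep => i; apply: addNr. Qed.

HB.instance Definition _ :=
  GRing.isZmodule.Build seq_module seq_addA seq_addC seq_add0 seq_addN.

Definition seq_scale a v : seq_module := fun i => a *: v i.

Fact seq_scalerA a b v : seq_scale a (seq_scale b v) = seq_scale (a * b) v.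
Proof. by apply: functional_extensionality_dep => i; apply: scalerA. Qed.
Fact seq_scale1r : left_id 1 seq_scale.
Proof. by move=> v; apply: functional_extensionality_dep => i; apply: scale1r. Qed.
Fact seq_scalerDr : right_distributive seq_scale +%R.
Proof. by move=> a v w; apply: functional_extensionality_dep => i; apply: scalerDr. Qed.
Fact seq_scalerDl v : {morph seq_scale^~ v : a b / a + b}.
Proof. by move=> a b; apply: functional_extensionality_dep => i; apply: scalerDl. Qed.

HB.instance Definition _ := GRing.Zmodule_isLmodule.Build A seq_module
  seq_scalerA seq_scale1r seq_scalerDr seq_scalerDl.

End SequenceModule.

Section Colimit.
Variables (A : nzRingType) (X : nat -> lmodType A).
Variable f : forall i, {linear X i -> X i.+1}.
Hypothesis fI : forall i, injective (f i).

Definition null_seq : set (seq_module X) :=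
  [set w | exists n, forall k, (n <= k)%N -> w k = 0].

Lemma null_seq_submod : is_submod null_seq.
Proof.
split; first by exists 0%N.
move=> a v w [n vn] [m wm]; exists (maxn n m) => k; rewrite geq_max => /andP[nk mk].
by change (a *: v k + w k = 0); rewrite vn // wm // scaler0 addr0.
Qed.

(** The images of [x : X i] in the later modules of the chain, preceded by
    zeros. *)
Fixpoint thread i (x : X i) (k : nat) : X k :=
  match k return X k with
  | 0 => dfwith (fun j => 0 : X j) x 0%N
  | k'.+1 => if (k' < i)%N then dfwith (fun j => 0 : X j) x k'.+1
             else f k' (thread x k')
  end.

Lemma thread_step i (x : X i) k : (i <= k)%N -> thread x k.+1 = f k (thread x k).
Proof. by move=> ik; rewrite /= ltnNge ik. Qed.

Lemma thread_le i (x : X i) k :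
  (k <= i)%N -> thread x k = dfwith (fun j => 0 : X j) x k.
Proof. by case: k => //= k ->. Qed.

Lemma thread_diag i (x : X i) : thread x i = x.
Proof. by rewrite thread_le // dfwith_in. Qed.

Fact dfwith_linear i a (x y : X i) k :
  dfwith (fun j => 0 : X j) (a *: x + y) k =
  a *: dfwith (fun j => 0 : X j) x k + dfwith (fun j => 0 : X j) y k.
Proof.
have [<-|ik] := eqVneq i k; first by rewrite !dfwith_in.
by rewrite !dfwith_out // scaler0 addr0.
Qed.

Fact thread_linear i : linear (fun x : X i => (fun k => thread x k) : seq_module X).
Proof.
move=> a x y; apply: functional_extensionality_dep => k.
change (thread (a *: x + y) k = a *: thread x k + thread y k).
elim: k => [|k IHk] /=; first exact: dfwith_linear.
by case: ltnP => _; [exact: dfwith_linear|rewrite IHk linearP].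
Qed.

Lemma thread_eq i j (x : X i) (y : X j) n : (i <= n)%N -> (j <= n)%N ->
  thread x n = thread y n -> forall k, (n <= k)%N -> thread x k = thread y k.
Proof.
move=> i_n j_n eq_n k /subnK <-; elim: (k - n)%N => // m IHm.
by rewrite addSn !thread_step ?IHm //; lia.
Qed.

Lemma thread_inj i (x y : X i) k :
  (i <= k)%N -> thread x k = thread y k -> x = y.
Proof.
move=> /subnK <-; elim: (k - i)%N => [|m IHm]; first by rewrite !thread_diag.
by rewrite addSn !thread_step; try lia; move=> /fI.
Qed.

(** The union of the chain is found among sequences modulo those that vanish
    eventually: an element of [X i] is represented by its thread. *)
Lemma exists_colimit : exists (M : lmodType A) (j : forall i, {linear X i -> M}),
  [/\ forall i, injective (j i), forall i x, j i.+1 (f i x) = j i x &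
      forall m, exists i x, m = j i x].
Proof.
pose pi := quot_map null_seq_submod.
pose t i : {linear X i -> quot_module null_seq_submod} :=
  pi \o to_linear (@thread_linear i).
have tE i x : t i x = pi (fun k => thread x k) by [].
have t_eq i i' (x : X i) (y : X i') n : (i <= n)%N -> (i' <= n)%N ->
    thread x n = thread y n -> t i x = t i' y.
  move=> i_n i'_n eq_n; apply/quot_module_eq; exists n => k nk.
  change (thread x k - thread y k = 0).
  by rewrite (thread_eq i_n i'_n eq_n nk) subrr.
have tf i x : t i.+1 (f i x) = t i x.
  by apply: (t_eq _ _ _ _ i.+1) => //; rewrite thread_diag thread_step ?thread_diag.
have tI i : injective (t i).
  move=> x y /quot_module_eq[n xy0]; apply: (@thread_inj _ _ _ (maxn i n)).
    exact: leq_maxl.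
  have := xy0 _ (leq_maxr i n); change (_ = 0) with (thread x (maxn i n) - thread y (maxn i n) = 0).
  by move/eqP; rewrite subr_eq0 => /eqP.
pose V := [set p | exists i x, p = t i x].
have incV i k x : exists y, t i x = t (k + i)%N y.
  elim: k => [|k [y ->]]; first by exists x.
  by exists (f _ y); rewrite tf.
have sV : is_submod V.
  split; first by exists 0%N, 0; rewrite linear0.
  move=> a _ _ [i [x ->]] [i' [x' ->]].
  have [y ->] := incV i i' x; have [y' ->] := incV i' i x'.
  rewrite [(i + i')%N]addnC in y' *.
  by exists (i' + i)%N, (a *: y + y'); rewrite linearP.
have tV i x : t i x \in of_set sV by apply/asboolP; exists i, x.
exists (submod (of_set sV)), (fun i => corestr (tV i)); split.
- by move=> i x y /(congr1 val); apply: tI.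
- by move=> i x; apply: val_inj; apply: tf.
- move=> [m mV]; have /asboolP[i [x mE]] := mV.
  by exists i, x; apply: val_inj.
Qed.

End Colimit.

(** * A chain of subdirectly irreducible modules and its union *)

Section Chain.
Variables (A : nzRingType) (C : lmodType A -> Prop).
Hypotheses (subC : subcategory C) (clC : submodule_closed C).

Definition strict_chain (X : nat -> lmodType A)
    (f : forall i, {linear X i -> X i.+1}) : Prop :=
  forall i, [/\ subdirectly_irreducible C (X i), injective (f i) &
                ~ forall y, exists x, f i x = y].

Lemma exists_strict_chain : infinite_subcat C ->
  (~ exists D, [/\ subcategory D, proper_subcat D C, infinite_subcat D &
                   submodule_closed D]) ->
  exists (X : nat -> lmodType A) (f : forall i, {linear X i -> X i.+1}),
    strict_chain f.
Proof.
move=> infC minC.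
have inf := infinitely_many_subdirectly_irreducible subC clC infC minC.
have next (R : {R | subdirectly_irreducible C R}) :
    exists R' : {R | subdirectly_irreducible C R},
    exists f : {linear (sval R : lmodType A) -> (sval R' : lmodType A)},
      injective f /\ ~ forall y, exists x, f x = y.
  case: R => R0 irrR.
  have [||Y [irrY nYR] [f fI]] := @subdirectly_irreducible_embeds_infinite
      A C subC clC minC (fun Y => subdirectly_irreducible C Y /\ ~ isomorphic Y R0) _ irrR.
  - move=> Y [irrY _]; split; first by case: irrY.
    exact: (subdirectly_irreducible_indecomposable subC clC irrY).
  - move=> fin; apply: inf.
    apply: finitely_many_sub (finitely_many_or fin (finitely_many_iso R0)) => Y irrY.
    by have [|] := pselect (isomorphic Y R0); [right|left].
  exists (exist _ Y irrY), f; split=> // fS.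
  exact/nYR/iso_sym/(iso_inj_surj fI).
have [R0 irr0] : exists R, subdirectly_irreducible C R.
  apply: contrapT => none; apply: inf.
  by exists 0%N, (fun=> A^o) => X irrX; case: none; exists X.
have [g gP] := choice next.
pose X i := sval (iter i g (exist _ R0 irr0)).
have step i : {f : {linear X i -> X i.+1} |
    injective f /\ ~ forall y, exists x, f x = y}.
  exact/cid/gP.
exists X, (fun i => sval (step i)) => i.
have [fI fS] := svalP (step i); split=> //; exact: svalP.
Qed.

Variables (X : nat -> lmodType A) (f : forall i, {linear X i -> X i.+1}).
Hypothesis chain : strict_chain f.

Lemma chain_embeds i j : (i <= j)%N -> embeds (X i) (X j).
Proof.
move=> /subnK <-; elim: (j - i)%N => [|k IHk]; first by exists idfun.
by apply: embeds_trans IHk _; exists (f (k + i)); case: (chain (k + i)).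
Qed.

Lemma chain_lenle i n : lenle (X i) n -> (i < n)%N.
Proof.
elim: i n => [|i IHi] [|n] // lenX.
- by have [[_ [z z0 _]] _ _] := chain 0; case: z0; apply: (lenle0 _).1.
- by have [[_ [z z0 _]] _ _] := chain i.+1; case: z0; apply: (lenle0 _).1.
- by rewrite ltnS; apply: IHi; have [_ fI fS] := chain i; apply: lenle_inj_strict fI fS lenX.
Qed.

Lemma chain_infinite : ~ finitely_many_iso_classes (fun Y => exists i, Y = X i).
Proof.
move=> fin; have [Y [i ->]|n lenX] := finitely_many_bounded fin.
  by have [[CX _] _ _] := chain i; apply: (closed_lenle subC CX).
have lenXn : lenle (X n) n by apply: lenX; exists n.
by have := chain_lenle lenXn; rewrite ltnn.
Qed.

Variables (M : lmodType A) (j : forall i, {linear X i -> M}).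
Hypotheses (jI : forall i, injective (j i))
  (jf : forall i x, j i.+1 (f i x) = j i x)
  (jM : forall m, exists i x, m = j i x).

Lemma chain_image_le i k : (i <= k)%N -> forall x, exists y, j i x = j k y.
Proof.
move=> /subnK <-; elim: (k - i)%N => [|n IHn] x; first by exists x.
by have [y ->] := IHn x; exists (f _ y); rewrite jf.
Qed.

Lemma finite_length_lands (Y : lmodType A) (g : {linear Y -> M}) n :
  lenle Y n -> exists i, exists h : {linear Y -> X i}, forall y, g y = j i (h y).
Proof.
move=> lenY.
have sP i : is_submod (g @^-1` range (j i)).
  exact/is_submod_preimage/is_submod_image.
have [||||||i Yi] := @len_le_union _ _ [set 0] setT n
  (fun i => g @^-1` range (j i)) => //.
- move=> i y [x _ gy]; exists (f i x) => //.
  by rewrite jf.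
- by move=> _ ->; exists 0 => //; rewrite !linear0.
- by move=> y _; have [i [x gy]] := jM (g y); exists i, x.
have /choice[h hP] y : exists x, g y = j i x.
  by have [//|x _ gy] := Yi y; exists x.
have lh : linear h.
  by move=> a x y; apply: (@jI i); rewrite linearP -!hP linearP.
by exists i, (to_linear lh).
Qed.

Lemma subdirectly_irreducible_union (R : lmodType A) (g : {linear R -> M}) (z : R) :
  C R -> (forall Y, C Y -> forall h : {linear R -> Y}, injective h \/ h z = 0) ->
  injective g \/ g z = 0.
Proof.
move=> CR zP; have [n lenR] := closed_lenle subC CR.
have [i [h gE]] := finite_length_lands g lenR.
have [[CX _] _ _] := chain i.
have [hI|hz] := zP _ CX h; [left=> x y|right].
  by rewrite !gE => /jI/hI.
by rewrite gE hz linear0.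
Qed.

(** Of the two projections of a decomposition one is injective on [X i] for
    each [i] by subdirect irreducibility, although each of them kills a nonzero
    element, which lies in [X i] for [i] large. *)
Lemma union_indecomposable : indecomposable M.
Proof.
split.
  move=> M0; have [[_ [z z0 _]] _ _] := chain 0.
  by apply: z0; apply: (@jI 0); rewrite (M0 (j 0 z)) linear0.
move=> V W [p [q pK qK]]; apply: contrapT => /not_orP[].
move=> /existsNP[v v0] /existsNP[w w0].
pose q' : {linear (V * W)%type -> M} := to_linear (can2_linear pK qK).
have [iv [xv vE]] := jM (q' (v, 0)).
have [iw [xw wE]] := jM (q' (0, w)).
pose i := maxn iv iw.
have [x xE] := chain_image_le (leq_maxl iv iw) xv.
have [y yE] := chain_image_le (leq_maxr iv iw) xw.
have {xE vE}px : p (j i x) = (v, 0) by rewrite -xE -vE; apply: qK.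
have {yE wE}py : p (j i y) = (0, w) by rewrite -yE -wE; apply: qK.
have [[CX [z z0 zP]] _ _] := chain i.
pose e : {linear M -> M} := q' \o pairing (pfst V W \o p) \0.
pose e' : {linear M -> M} := q' \o pairing \0 (psnd V W \o p).
have ee' m : m = e m + e' m.
  transitivity (q' (((p m).1, 0) + (0, (p m).2))); last by rewrite linearD.
  rewrite -[LHS]pK; congr (q _).
  by rewrite [LHS]surjective_pairing; congr pair; rewrite /= ?addr0 ?add0r.
have [eI|ez] := subdirectly_irreducible_union (e \o j i : {linear _ -> _}) CX zP.
  have y0 : y = 0.
    apply: eI; rewrite linear0 /=; rewrite -[RHS](linear0 q'); congr (q _).
    by congr pair; rewrite /= py.
  by apply: w0; have := congr1 snd py; rewrite y0 !linear0.
have [e'I|e'z] := subdirectly_irreducible_union (e' \o j i : {linear _ -> _}) CX zP.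
  have x0 : x = 0.
    apply: e'I; rewrite linear0 /=; rewrite -[RHS](linear0 q'); congr (q _).
    by congr pair; rewrite /= px.
  by apply: v0; have := congr1 fst px; rewrite x0 !linear0.
apply: z0; apply: (@jI i); rewrite linear0 (ee' (j i z)).
by rewrite [e _]ez [e' _]e'z addr0.
Qed.

Hypothesis minC : ~ exists D, [/\ subcategory D, proper_subcat D C,
  infinite_subcat D & submodule_closed D].

(** Adding one map at a time shortens the kernel, so that [Y] embeds into a finite
    product of objects of [C]. *)
Lemma closed_cogenerated (Y : lmodType A) n :
  lenle Y n -> cogenerated_by C Y -> C Y.
Proof.
move=> lenY cogY.
suff ind k (Z : lmodType A) (g : {linear Y -> Z}) : C Z ->
    len_le [set 0] [set y | g y = 0] k -> C Y.
  pose O := of_set (is_submod0 Y).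
  have O0 : zero_module (submod O).
    by case=> o oO; apply: val_inj; have /asboolP := oO.
  apply: (ind n (submod O) \0 (subcat_zero subC O0)).
  by apply: len_le_sub lenY.
elim: k Z g => [|k IHk] Z g CZ leng.
  apply: (closed_embeds subC clC _ CZ); exists g.
  by apply: linear_injP => y /leng.
have [g0|/existsNP[y /not_implyP[gy y0]]] := pselect (forall y, g y = 0 -> y = 0).
  by apply: (closed_embeds subC clC _ CZ); exists g; apply: linear_injP.
have [Z' CZ' [h hy]] := cogY y y0.
apply: (IHk (Z * Z')%type (pairing g h)); first exact: (subcat_sum subC).
apply: leng.
- exact: is_submod_ker.
- by move=> _ ->; rewrite /= !linear0.
- by move=> x [].
- by move=> /(_ y gy) []. 
Qed.

Lemma cogenerated_union (Y : lmodType A) : C Y <-> cogenerated M Y.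
Proof.
split=> [CY|[/finite_length_lenle[n lenY] cogY]].
  split=> [|y y0]; first exact: (subcat_length subC).
  apply: contrapT => ny0.
  have [|Z [i ->] [g gy]] := infinite_family_cogenerates subC clC minC
      (F := fun Y => exists i, Y = X i) _ chain_infinite CY ny0.
    move=> Z [i ->]; have [irrX _ _] := chain i.
    split; first by case: irrX.
    exact: (subdirectly_irreducible_indecomposable subC clC irrX).
  apply: gy; apply: (@jI i); rewrite linear0.
  exact: (y0 (j i \o g : {linear _ -> _})).
apply: (closed_cogenerated lenY) => y ny0.
have /existsNP[g gy] : ~ forall g : {linear Y -> M}, g y = 0.
  by move=> /cogY.
have [i [h gE]] := finite_length_lands g lenY.
have [[CX _] _ _] := chain i.
by exists (X i) => //; exists h => hy; apply: gy; rewrite gE hy linear0.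
Qed.

End Chain.

(** * Generators, retractions and multiplicities *)

Section Generation.
Variable A : nzRingType.

Fixpoint span_from (M : lmodType A) (B : set M) (x : nat -> M) (k : nat) : set M :=
  if k is k'.+1 then adjoin (span_from B x k') (x k') else B.

Lemma span_from_submod (M : lmodType A) (B : set M) x k :
  is_submod B -> is_submod (span_from B x k).
Proof. by move=> sB; elim: k => //= k IHk; apply: is_submod_adjoin. Qed.

Lemma sub_span_from (M : lmodType A) (B : set M) x k : B `<=` span_from B x k.
Proof.
by elim: k => //= k IHk; apply: subset_trans IHk _; apply: sub_adjoin.
Qed.

Lemma len_le_generated (M : lmodType A) (B T : set M) n :
  is_submod B -> is_submod T -> B `<=` T -> len_le B T n ->
  exists s : seq M, [/\ (size s <= n)%N, forall x, x \in s -> T x &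
    forall V, is_submod V -> B `<=` V -> (forall x, x \in s -> V x) -> T `<=` V].
Proof.
move=> + sT; elim: n B => [|n IHn] B sB BT lenT.
  by exists [::]; split=> // V _ BV _; apply: subset_trans BV.
have [TB|/existsNP[b /not_implyP[Tb Bb]]] := pselect (T `<=` B).
  by exists [::]; split=> // V _ BV _; apply: subset_trans BV.
have sB' := is_submod_adjoin b sB.
have B'T : adjoin B b `<=` T by apply: adjoin_sub.
have [|s [size_s sT' sP]] := IHn _ sB' B'T.
  apply: (len_le_up sB' _ B'T _ lenT); first exact: sub_adjoin.
  by move=> B'B; apply: Bb; apply/B'B/mem_adjoin.
exists (b :: s); split=> // [x|V sV BV Vs].
  by rewrite inE => /orP[/eqP ->|/sT'].
apply: sP => // [|x xs]; last by apply: Vs; rewrite inE xs orbT.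
by apply: adjoin_sub => //; apply: Vs; rewrite inE eqxx.
Qed.

(** Steinitz: among more elements than the length of the interval one lies in
    the submodule generated by the preceding ones. *)
Lemma len_le_dependent (M : lmodType A) (B T : set M) n (x : nat -> M) :
  is_submod B -> is_submod T -> B `<=` T -> len_le B T n -> (forall k, T (x k)) ->
  exists2 m, (m <= n)%N & forall V, is_submod V -> B `<=` V ->
    (forall k, (k < m)%N -> V (x k)) -> V (x m).
Proof.
move=> + sT; elim: n B x => [|n IHn] B x sB BT lenT Tx.
  by exists 0%N => // V _ BV _; apply/BV/lenT.
have [Bx|nBx] := pselect (B (x 0%N)); first by exists 0%N => // V _ BV _; apply: BV.
have sB' := is_submod_adjoin (x 0%N) sB.
have B'T : adjoin B (x 0%N) `<=` T by apply: adjoin_sub.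
have [||m m_n mP] := IHn _ (x \o S) sB' B'T.
- apply: (len_le_up sB' _ B'T _ lenT); first exact: sub_adjoin.
  by move=> B'B; apply: nBx; apply/B'B/mem_adjoin.
- by move=> k; apply: Tx.
exists m.+1 => // V sV BV Vx; apply: mP => // [|k km]; last exact: Vx.
by apply: adjoin_sub => //; apply: Vx.
Qed.

Lemma exists_maximal (M : lmodType A) (P : set M -> Prop) (B : set M) n :
  is_submod B -> P B -> len_le B setT n ->
  exists D, [/\ is_submod D, P D &
    forall V, is_submod V -> D `<=` V -> P V -> V `<=` D].
Proof.
elim: n B => [|n IHn] B sB PB lenB.
  by exists B; split=> // V _ _ _ x _; apply: lenB.
have [maxB|] := pselect (forall V, is_submod V -> B `<=` V -> P V -> V `<=` B).
  by exists B.
move=> /existsNP[V /not_implyP[sV /not_implyP[BV /not_implyP[PV VB]]]].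
by apply: (IHn V) => //; apply: len_le_up lenB.
Qed.

(** If [Y = D + V] then a retraction of [D] that vanishes on [D `&` V] extends
    by zero on [V]. *)
Lemma retract_extension (Y E : lmodType A) (D V : set Y) (sD : is_submod D)
    (i : {linear E -> submod (of_set sD)}) (q : {linear submod (of_set sD) -> E}) :
  is_submod V -> (forall y, msum D V y) -> cancel i q ->
  (forall d, V (sub_incl _ d) -> q d = 0) ->
  indecomposable Y -> ~ zero_module E -> isomorphic Y E.
Proof.
move=> sV DV iK q0 iY nzE.
have /choice[c cP] y : exists d : submod (of_set sD), V (y - sub_incl _ d).
  have [d [v [Dd Vv ->]]] := DV y.
  have dD : d \in of_set sD by apply/asboolP.
  by exists (Sub d dD); rewrite /= addrAC subrr add0r.
have q_eq y d : V (y - sub_incl _ d) -> q (c y) = q d.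
  move=> Vyd; apply/eqP; rewrite -subr_eq0 -linearB; apply/eqP/q0.
  have -> : sub_incl _ (c y - d) = (y - sub_incl _ d) - (y - sub_incl _ (c y)).
    by rewrite linearB opprB [RHS]addrC addrA subrK.
  exact: is_submodB.
have lq : linear (q \o c).
  move=> a x y /=; rewrite -linearP; apply: q_eq.
  rewrite linearP opprD addrACA -scalerBr.
  exact: sV.2.
apply: (retract_indecomposable (i := sub_incl _ \o i : {linear _ -> _})
  (q := to_linear lq)) => // e.
by rewrite -[RHS]iK; apply: q_eq; rewrite subrr; apply: sV.1.
Qed.

(** [E ^ N] is a direct summand of [W], given by its injections and
    projections. *)
Definition multiplicity_ge (N : nat) (E W : lmodType A) : Prop :=
  exists (i : nat -> {linear E -> W}) (p : nat -> {linear W -> E}),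
  forall a b, (a < N)%N -> (b < N)%N -> forall e,
    p a (i b e) = if a == b then e else 0.

Lemma multiplicity_ge_iso N E V W : isomorphic V W ->
  multiplicity_ge N E V -> multiplicity_ge N E W.
Proof.
move=> [f [g fK gK]] [i [p ip]].
pose g' : {linear W -> V} := to_linear (can2_linear fK gK).
exists (fun a => f \o i a : {linear _ -> _}), (fun a => p a \o g' : {linear _ -> _}).
move=> a b aN bN e; rewrite -ip //=; congr (p a _); exact: fK.
Qed.

Lemma multiplicity_ge_prod N M E V W :
  multiplicity_ge N E V -> multiplicity_ge M E W ->
  multiplicity_ge (N + M) E (V * W)%type.
Proof.
move=> [i [p ip]] [i' [p' ip']].
exists (fun a => if (a < N)%N then pairing (i a) \0 else pairing \0 (i' (a - N)%N)).
exists (fun a => if (a < N)%N then p a \o pfst V W : {linear _ -> _}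
                 else p' (a - N)%N \o psnd V W : {linear _ -> _}).
move=> a b aNM bNM e; case: (ltnP a N) => aN; case: (ltnP b N) => bN /=.
- by rewrite ip.
- by rewrite linear0; case: eqP => // ab; lia.
- by rewrite linear0; case: eqP => // ab; lia.
- rewrite ip'; try lia.
  by congr (if _ then _ else _); lia.
Qed.

(** If each of [m] indecomposables of length at most [l] occurs at most [N] times
    in a decomposition of [X], then [X] has length at most [m * N * l]. *)
Lemma exists_multiplicity (P : lmodType A -> Prop) m (E : 'I_m -> lmodType A) l :
  (forall V W X : lmodType A, P X -> isomorphic X (V * W)%type -> P V /\ P W) ->
  (forall X, P X -> indecomposable X -> lenle X l /\ exists k, isomorphic X (E k)) ->
  forall n N X, lenle X n -> P X -> ~ lenle X (m * N * l) ->
  exists k, [/\ indecomposable (E k), lenle (E k) l & multiplicity_ge N.+1 (E k) X].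
Proof.
move=> Psum PE n N X lenX PX nlenX.
have [c [cE clen]] : exists c : 'I_m -> nat,
    (forall k, multiplicity_ge (c k) (E k) X /\
       ((0 < c k)%N -> indecomposable (E k) /\ lenle (E k) l)) /\
    lenle X (\sum_k c k * l).
  elim: n X lenX PX {nlenX} => [|n IHn] X lenX PX.
    exists (fun=> 0%N); split; last by apply: lenleW lenX.
    by move=> k; split=> //; exists (fun=> \0), (fun=> \0).
  have [iX|/not_indecomposable[X0|]] := pselect (indecomposable X).
  - have [lenXl [k XE]] := PE X PX iX.
    exists (fun k' => k' == k : nat); split.
      move=> k'; case: eqP => [->|_] /=; last first.
        by split=> //; exists (fun=> \0), (fun=> \0).
      have [f [g fK gK]] := XE; split.
        exists (fun=> to_linear (can2_linear fK gK)), (fun=> f) => [[|//] [|//]] _ _ e.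
        exact: gK.
      move=> _; split; first exact: indecomposable_iso XE iX.
      by apply: lenle_iso lenXl; apply: iso_sym.
    rewrite (bigD1 k) //= eqxx mul1n big1 ?addn0 // => k' /negPf ->.
    by rewrite mul0n.
  - exists (fun=> 0%N); split; last by apply: (@lenleW _ _ 0) => //; apply/lenle0.
    by move=> k; split=> //; exists (fun=> \0), (fun=> \0).
  - move=> [V [W [XVW nzV nzW]]]; have [PV PW] := Psum V W X PX XVW.
    have lenVW : lenle (V * W)%type n.+1 by apply: lenle_iso lenX; apply: iso_sym.
    have lenV : lenle V n.
      apply: (lenle_inj_strict (f := pairing idfun (\0 : {linear V -> W}))) lenVW.
        by move=> x y [].
      by move=> fS; apply: nzW => w; have [v []] := fS (0, w).
    have lenW : lenle W n.
      apply: (lenle_inj_strict (f := pairing (\0 : {linear W -> V}) idfun)) lenVW.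
        by move=> x y [].
      by move=> fS; apply: nzV => v; have [w []] := fS (v, 0).
    have [c [cE clen]] := IHn V lenV PV; have [c' [cE' clen']] := IHn W lenW PW.
    exists (fun k => c k + c' k)%N; split; last first.
      apply: lenle_iso XVW _; under eq_bigr do rewrite mulnDl.
      by rewrite big_split; apply: lenle_prod.
    move=> k; have [[mV cV] [mW cW]] := (cE k, cE' k); split.
      apply: multiplicity_ge_iso (iso_sym XVW) _.
      exact: multiplicity_ge_prod.
    by rewrite addn_gt0 => /orP[/cV|/cW].
have [[k Nk]|none] := pselect (exists k, (N < c k)%N).
  have [[i [p ip]] ck] := cE k; exists k.
  have [|iE lenE] := ck; first by apply: leq_ltn_trans Nk.
  split=> //; exists i, p => a b aN bN; apply: ip; lia.
case: nlenX; apply: lenleW clen.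
rewrite -mulnA -[X in (_ <= X * _)%N]card_ord -sum_nat_const leq_sum // => k _.
by rewrite leq_mul2r leqNgt; apply/orP; right; apply/negP => Nk; apply: none; exists k.
Qed.

End Generation.

(** * Restriction of scalars *)

Section Restriction.
Variables (R : comNzRingType) (L : algType R).

Definition restrict_scalars (X : lmodType L) := (X : Type).

Section Structure.
Variable X : lmodType L.
HB.instance Definition _ := GRing.Zmodule.copy (restrict_scalars X) X.

Definition restrict_scale (r : R) (x : restrict_scalars X) : restrict_scalars X :=
  (r%:A : L) *: (x : X).

Fact restrict_scalerA a b x :
  restrict_scale a (restrict_scale b x) = restrict_scale (a * b) x.
Proof. by rewrite /restrict_scale scalerA -scalerAl mul1r scalerA. Qed.
Fact restrict_scale1r : left_id 1 restrict_scale.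
Proof. by move=> x; rewrite /restrict_scale scale1r scale1r. Qed.
Fact restrict_scalerDr : right_distributive restrict_scale +%R.
Proof. by move=> a x y; apply: scalerDr. Qed.
Fact restrict_scalerDl x : {morph restrict_scale^~ x : a b / a + b}.
Proof. by move=> a b; rewrite /restrict_scale scalerDl scalerDl. Qed.

HB.instance Definition _ := GRing.Zmodule_isLmodule.Build R (restrict_scalars X)
  restrict_scalerA restrict_scale1r restrict_scalerDr restrict_scalerDl.

Lemma restrict_scaleE (r : R) (x : X) :
  (r *: (x : restrict_scalars X)) = ((r%:A : L) *: x :> X).
Proof. by []. Qed.

(** Scalars from [R] are central in [L]. *)
Lemma act_restrict_linear (a : L) :
  linear (fun x : restrict_scalars X => (a *: (x : X)) : restrict_scalars X).
Proof.
move=> r x y; rewrite restrict_scaleE [LHS]scalerDr; congr (_ + _).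
by rewrite restrict_scaleE !scalerA mulr_algl mulr_algr.
Qed.

Definition act_restrict (a : L) : {linear restrict_scalars X -> restrict_scalars X} :=
  to_linear (act_restrict_linear a).

Lemma is_submod_restrict (V : set X) :
  is_submod V -> @is_submod R (restrict_scalars X) V.
Proof. by move=> sV; split; [exact: sV.1|move=> r x y; apply: sV.2]. Qed.

Lemma len_le_restrict (B T : set X) n :
  @len_le R (restrict_scalars X) B T n -> len_le B T n.
Proof.
elim: n T => [|n IHn] T lenT //= V sV BV VT TV.
by apply: IHn; apply: lenT => //; apply: is_submod_restrict.
Qed.

End Structure.

Fact restrict_map_linear (X Y : lmodType L) (f : {linear X -> Y}) :
  linear (f : restrict_scalars X -> restrict_scalars Y).
Proof. by move=> r x y; apply: linearP. Qed.

Definition restrict_map (X Y : lmodType L) (f : {linear X -> Y}) :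
  {linear restrict_scalars X -> restrict_scalars Y} := to_linear (restrict_map_linear f).

Fact act_linear (X : lmodType L) (x : X) : linear (fun a : L^o => a *: x).
Proof. by move=> a b c; rewrite scalerDl scalerA. Qed.

Definition act (X : lmodType L) (x : X) : {linear L^o -> X} :=
  to_linear (act_linear x).

End Restriction.

(** * Modules over an artin algebra *)

Section Artin.
Variables (R : comNzRingType) (L : algType R).

Lemma artinian_sets (M : lmodType R) (U : nat -> set M) :
  artinian_module M -> (forall i, is_submod (U i)) ->
  (forall i, U i.+1 `<=` U i) -> exists n, forall m, (n <= m)%N -> U n `<=` U m.
Proof.
move=> artM sU decU; have [i x|n nP] := artM (fun i => of_set (sU i)).
  by rewrite !mem_of_set => /asboolP/decU Ux; apply/asboolP.
exists n => m nm x Ux; have := nP m nm x.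
by rewrite !mem_of_set [RHS](asboolT Ux) => /asboolP.
Qed.

Lemma decreasing_le (T : Type) (U : nat -> set T) :
  (forall i, U i.+1 `<=` U i) -> forall i j, (i <= j)%N -> U j `<=` U i.
Proof.
move=> decU i j /subnK <-; elim: (j - i)%N => // k IHk x /decU.
exact: IHk.
Qed.

Hypothesis artR : artinian_module R^o.

Section Generators.
Variable g : nat -> L.

Local Notation gspan := (span_from [set 0] g).

Fact gspan_submod k : is_submod (gspan k).
Proof. exact/span_from_submod/is_submod0. Qed.

(** Descending chains are compared on each [gspan k] in turn; the ideals of
    coefficients of [g k] control the step. *)
Lemma gspan_dcc k (U : nat -> set L) : (forall i, is_submod (U i)) ->
  (forall i, U i.+1 `<=` U i) ->
  exists n, forall m, (n <= m)%N -> U n `&` gspan k `<=` U m.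
Proof.
move=> sU decU; elim: k => [|k [n0 n0P]].
  by exists 0%N => m _ x [_ /= ->]; apply: (sU m).1.
pose J i : set R^o := [set r | exists2 w, gspan k w & U i (r *: g k + w)].
have sG := gspan_submod k.
have sJ i : is_submod (J i).
  split; first by exists 0; [exact: sG.1|rewrite scale0r addr0; exact: (sU i).1].
  move=> a r s [v Gv Uv] [w Gw Uw]; exists (a *: v + w); first exact: sG.2.
  rewrite scalerDl -scalerA addrACA -scalerDr; exact: (sU i).2.
have decJ i : J i.+1 `<=` J i by move=> r [w Gw /decU Uw]; exists w.
have [n1 n1P] := artinian_sets artR sJ decJ.
exists (maxn n0 n1) => m; rewrite geq_max => /andP[n0m n1m] x [Ux [r Gw]].
have {Ux} [Un0 Un1] := (decreasing_le decU (leq_maxl n0 n1) Ux,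
                        decreasing_le decU (leq_maxr n0 n1) Ux).
have [|w' Gw' Uw'] := n1P m n1m r.
  by exists (x - r *: g k) => //; rewrite addrC subrK.
rewrite -[x](subrK (r *: g k + w')); apply: is_submodD => //.
apply: n0P => //; split.
  apply: is_submodB => //.
  exact: (decreasing_le decU n0m Uw').
rewrite opprD addrA; exact: is_submodB.
Qed.

Lemma gspan_sum n (c : nat -> R) : gspan n (\sum_(i < n) c i *: g i).
Proof.
elim: n => [|n IHn]; first by rewrite big_ord0.
by exists (c n); rewrite big_ord_recr addrK.
Qed.

Variable n : nat.
Hypothesis gT : forall x, gspan n x.

Lemma left_ideal_submod (I : set L^o) : is_submod I -> @is_submod R L I.
Proof.
move=> sI; split; first exact: sI.1.
by move=> r x y Ix Iy; rewrite -mulr_algl; apply: sI.2.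
Qed.

(** A finitely generated algebra over an artinian ring is left artinian. *)
Lemma minimal_left_ideal (S : set L^o -> Prop) : (exists I, S I) ->
  (forall I, S I -> is_submod I) ->
  exists2 I, S I & forall J, S J -> J `<=` I -> I `<=` J.
Proof.
move=> [I0 SI0] Ssub; apply: contrapT => none.
have next (I : {I | S I}) : exists J : {J | S J},
    sval J `<=` sval I /\ ~ sval I `<=` sval J.
  case: I => I SI; apply: contrapT => nI; apply: none; exists I => // J SJ JI.
  by apply: contrapT => IJ; apply: nI; exists (exist _ J SJ).
have [f fP] := choice next.
pose U i : set L := sval (iter i f (exist _ I0 SI0)).
have [||m mP] := @gspan_dcc n U.
- by move=> i; apply/left_ideal_submod/Ssub/svalP.
- by move=> i; have [] := fP (iter i f (exist _ I0 SI0)).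
have [_] := fP (iter m f (exist _ I0 SI0)); apply => x Ux.
by apply: (mP m.+1) => //; split.
Qed.

(** Annihilators of elements of modules of finite length have finite colength,
    and so have their finite intersections; a minimal one is contained in every
    annihilator. *)
Lemma common_annihilator : exists (I : set L^o) t,
  [/\ is_submod I, len_le I setT t &
    forall (X : lmodType L) k, lenle X k -> forall (x : X) a, I a -> a *: x = 0].
Proof.
have [||I [sI [t lenI]] minI] := minimal_left_ideal
    (S := fun I => is_submod I /\ exists t, len_le I setT t).
- by exists setT; split=> //; exists 0%N.
- by move=> I [].
exists I, t; split=> // X k lenX x.
pose J := I `&` [set a | act x a = 0].
have sJ : is_submod J by apply: is_submodI => //; apply: is_submod_ker.
suff [t' lenJ] : exists t, len_le J setT t.
  by move=> a /(minI J (conj sJ (ex_intro _ t' lenJ))) IJ; have [|_] := IJ; [move=> ? []|].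
exists (k + t)%N; apply: (len_le_trans sI _ _ _ _ lenI) => //; first by move=> ? [].
apply: (len_le_domain (f := act x)) lenX => //; apply: is_submod0.
Qed.

(** On a simple subquotient [V / B] every scalar acts as zero or invertibly,
    since [R] is artinian. *)
Lemma simple_scalar_inverse (X : lmodType L) (B V : set X) (v : X) (r : R) :
  is_submod B -> is_submod V -> B `<=` V -> V v ->
  (forall W, is_submod W -> B `<=` W -> W `<=` V -> ~ W `<=` B -> V `<=` W) ->
  ~ B (r%:A *: v) -> exists s : R, B ((1 - r * s)%:A *: v).
Proof.
move=> sB sV BV Vv minV nBr.
have rI y : V y -> B (r%:A *: y) -> B y.
  move=> Vy Bry; pose K := V `&` [set y | B (r%:A *: y)].
  have sK : is_submod K.
    apply: is_submodI => //; split; first by rewrite /= scaler0; apply: sB.1.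
    move=> a x z /= Bx Bz; rewrite scalerDr scalerA mulr_algl -mulr_algr -scalerA.
    exact: sB.2.
  have [KB|nKB] := pselect (K `<=` B); first exact: KB.
  have Kv : K v.
    apply: (minV K) => // [x Bx|x []] //.
    by split; [exact: BV|exact: is_submodZ].
  by case: nBr; case: Kv.
have [||m mP] := @artinian_sets R^o
    (fun k => [set t : R^o | exists s : R, t = r ^+ k * s]) artR.
- move=> k; split; first by exists 0; rewrite mulr0.
  by move=> a _ _ [s ->] [s' ->]; exists (a * s + s'); rewrite mulrDr mulrCA.
- by move=> k _ [s ->]; exists (r * s); rewrite exprSr mulrA.
have [|s rs] := mP m.+1 (leqnSn m) (r ^+ m); first by exists 1; rewrite mulr1.
exists s; have : B ((r ^+ m * (1 - r * s))%:A *: v).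
  rewrite mulrBr mulr1 mulrA -exprSr -rs subrr scale0r scale0r; exact: sB.1.
elim: m {mP rs} (1 - r * s) => [|m IHm] c; first by rewrite mul1r.
rewrite exprS -mulrA -scalerA -mulr_algl -scalerA => /rI rc.
apply: IHm; apply: rc; exact: is_submodZ.
Qed.

(** By Schur, [V / B] is a vector space over a residue field of [R], spanned by
    the multiples of [v] by the generators of [L]. *)
Lemma finite_restrict_simple (X : lmodType L) (B V : set X) (v : X) :
  is_submod B -> is_submod V -> B `<=` V -> V v -> ~ B v ->
  (forall W, is_submod W -> B `<=` W -> W `<=` V -> ~ W `<=` B -> V `<=` W) ->
  @len_le R (restrict_scalars X) B V n.
Proof.
move=> sB sV BV Vv nBv minV.
pose G := span_from (B : set (restrict_scalars X)) (fun k => g k *: v).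
have sG k : is_submod (G k) by apply/span_from_submod/is_submod_restrict.
have BG k : B `<=` G k by exact: (@sub_span_from R (restrict_scalars X) B).
have VG : V `<=` G n.
  have VB : V `<=` adjoin B v.
    apply: minV => //; [exact: is_submod_adjoin|exact: sub_adjoin| |].
      exact: adjoin_sub.
    by move=> sub; apply: nBv; apply/sub/mem_adjoin.
  move=> x /VB[a]; have := gT a.
  elim: n a x => [a x -> |k IHk a x [r ra] Bxa]; first by rewrite scale0r subr0.
  exists r; apply: (IHk _ _ ra).
  rewrite restrict_scaleE scalerA mulr_algl scalerBl opprB.
  by rewrite addrA subrK.
suff lenG k : @len_le R (restrict_scalars X) B (G k) k by apply: len_le_sub (lenG n).
elim: k => [|k IHk] //; rewrite -addn1.
apply: (@len_le_trans _ _ _ (G k)) => //; rewrite addn1.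
  exact: sub_adjoin.
move=> W sW GW WG nGW w Ww; have [r Gwr] := WG w Ww.
have [Br|nBr] := pselect (B (r%:A *: v)).
  rewrite -[w](subrK (r *: (g k *: v : restrict_scalars X))).
  apply: is_submodD => //; apply: BG.
  rewrite restrict_scaleE scalerA mulr_algl -mulr_algr -scalerA.
  exact: is_submodZ.
have [s Bs] := simple_scalar_inverse sB sV BV Vv minV nBr.
case: nGW; apply: adjoin_sub => //.
have Wr : W (r *: (g k *: v : restrict_scalars X)).
  rewrite -[_ *: _](subKr w); apply: is_submodB => //; exact: GW.
have gE : g k = s%:A * (r%:A * g k) + g k * (1 - r * s)%:A.
  rewrite !(mulr_algl, mulr_algr) scalerA -scalerDl [s * r]mulrC.
  by rewrite addrC subrK scale1r.
have -> : g k *: v = s *: (r *: (g k *: v : restrict_scalars X)) +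
    (g k *: ((1 - r * s)%:A *: v) : restrict_scalars X).
  by rewrite [in LHS]gE (scalerDl v) -!scalerA.
apply: is_submodD => //; first exact: is_submodZ.
apply/GW/BG; exact: is_submodZ.
Qed.

Lemma finite_restrict (X : lmodType L) (B T : set X) k :
  is_submod B -> is_submod T -> B `<=` T -> len_le B T k ->
  exists m, @len_le R (restrict_scalars X) B T m.
Proof.
move=> + sT; elim: k B => [|k IHk] B sB BT lenT; first by exists 0%N.
have [TB|TB] := pselect (T `<=` B); first by exists 0%N.
have [V [sV BV VT VB minV]] := len_le_atom sT BT TB lenT.
have [m lenm] := IHk V sV VT (len_le_up sV BV VT VB lenT).
have /existsNP[v /not_implyP[Vv nBv]] := VB.
exists (n + m)%N; apply: (len_le_trans (C := V : set (restrict_scalars X))) lenm => //.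
- exact: is_submod_restrict.
- exact: is_submod_restrict.
- exact: finite_restrict_simple Vv nBv minV.
Qed.

End Generators.

Section EssentialExtension.
Variables (Y : lmodType L) (D U : set Y) (u : nat).
Hypotheses (sD : is_submod D) (sU : is_submod U).
Hypothesis UD0 : forall y, U y -> D y -> y = 0.
Hypothesis essU : forall V, is_submod V -> D `<=` V -> ~ V `<=` D ->
  exists y, [/\ U y, V y & y <> 0].
Hypothesis lenU : @len_le R (restrict_scalars Y) [set 0] U u.

(** The inverse image in [Y] of [Hom (L / I, Y / D)], seen as a subset of
    [Y / D]. *)
Definition annihilated (I : set L^o) : set Y :=
  [set y | forall a, I a -> D (a *: y)].

Lemma annihilated_submod I : @is_submod R (restrict_scalars Y) (annihilated I).
Proof.
split; first by move=> a _; rewrite scaler0; exact: sD.1.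
move=> r x y Ix Iy a Ia.
rewrite (linearP (act_restrict Y a) r x y).
by apply: (is_submod_restrict sD).2; [apply: Ix|apply: Iy].
Qed.

(** Multiplication by an element of [J] outside [I] embeds the factor into the
    socle of [Y / D] since [J / I] is simple, and this socle lies in the image
    of [U] since [U] is essential. *)
Lemma len_le_annihilated_step (I J : set L^o) :
  is_submod I -> is_submod J -> I `<=` J -> ~ J `<=` I ->
  (forall W, is_submod W -> I `<=` W -> W `<=` J -> ~ W `<=` I -> J `<=` W) ->
  @len_le R (restrict_scalars Y) (annihilated J) (annihilated I) u.
Proof.
move=> sI sJ IJ /existsNP[a /not_implyP[Ja nIa]] minJ.
have Jsub b : J b -> ~ I b -> J `<=` adjoin I b.
  move=> Jb nIb; apply: minJ; first exact: is_submod_adjoin.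
  - exact: sub_adjoin.
  - exact: adjoin_sub.
  - by move=> sub; apply/nIb/sub/mem_adjoin.
have sRD := is_submod_restrict sD; have sRU := is_submod_restrict sU.
have sDU : is_submod (msum D U) by exact: is_submod_sum.
apply: (len_le_domain (f := act_restrict Y a) (B' := D) (T' := msum D U)) => //.
- exact: annihilated_submod.
- exact: is_submod_restrict.
- exact: sub_msuml.
- move=> x Ix; change (msum D U (a *: x)).
  have [Dax|nDax] := pselect (D (a *: x)); first exact: sub_msuml.
  have [||y [Uy [l Dyl] y0]] := essU (is_submod_adjoin (a *: x) sD).
  + exact: sub_adjoin.
  + by move=> sub; apply/nDax/sub/mem_adjoin.
  have nIla : ~ I (l *: a).
    move=> Ila; apply: y0; apply: UD0 => //.
    rewrite -[y](subrK (l *: (a *: x))); apply: is_submodD => //.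
    by rewrite scalerA; apply: Ix.
  have [l' Ial'] := Jsub (l *: a) (is_submodZ sJ l Ja) nIla a Ja.
  have -> : a *: x = (a - l' *: (l *: a)) *: x + l' *: (l *: (a *: x)).
    by rewrite scalerBl !scalerA subrK.
  apply: is_submodD => //; first by apply: sub_msuml => //; apply: Ix.
  apply: is_submodZ => //; exists (l *: (a *: x) - y), y; split=> //.
    by rewrite -opprB; apply: is_submodN.
  by rewrite subrK.
- move=> x Ix Dax b /(Jsub a Ja nIa)[c Ibc].
  rewrite -[b](subrK (c *: (a : L^o))) scalerDl; apply: is_submodD => //.
    exact: Ix.
  by rewrite -scalerA; apply: is_submodZ.
- apply: (len_le_codomain (f := idfun : {linear restrict_scalars Y -> restrict_scalars Y})) lenU => //.
  + by move=> _ ->; apply: sRU.1.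
  + by move=> _ ->; apply: sD.1.
Qed.

(** Essential extensions have bounded length. Filtering [L] with simple factors
    [J / I] exhibits [Y / D = Hom (L, Y / D)] as an iterated extension of the
    [R]-modules [Hom (J / I, Y / D)], each of which embeds into [U]. *)
Lemma finite_essential_extension (I : set L^o) t :
  is_submod I -> len_le I setT t -> (forall a y, I a -> D (a *: y)) ->
  @len_le R (restrict_scalars Y) D setT (t * u).
Proof.
move=> sI lenI ID.
suff : @len_le R (restrict_scalars Y) D (annihilated I) (t * u).
  by apply: len_le_sub => // y _ a; apply: ID.
elim: t I sI lenI {ID} => [|t IHt] I sI lenI.
  by move=> y Iy; rewrite -[y]scale1r; apply/Iy/lenI.
have [TI|TI] := pselect (setT `<=` I).
  by apply: len_le_refl => y Iy; rewrite -[y]scale1r; apply/Iy/TI.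
have [J [sJ IJ JT JI minJ]] := len_le_atom (is_submodT L^o) (fun _ _ => Logic.I) TI lenI.
have lenJ := IHt J sJ (len_le_up sJ IJ JT JI lenI).
rewrite mulSn addnC.
apply: (len_le_trans (C := annihilated J : set (restrict_scalars Y))) lenJ _ => //.
- exact: annihilated_submod.
- exact: annihilated_submod.
- by move=> y Dy a _; apply: is_submodZ.
- by move=> y Jy a /IJ; apply: Jy.
- exact: len_le_annihilated_step.
Qed.

End EssentialExtension.

End Artin.

(** * Cofinality of the chain *)

Section Embedding.
Variables (R : comNzRingType) (L : algType R).

(** Restricted to [V], maps to [E] form an [R]-module of length at most [c * u],
    as they are determined by their values on [c] generators.  So one of the
    projections to [E] agrees on [V] with an [R]-combination [q] of the preceding
    ones, and subtracting [q] does not affect the composite with its own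
    injection. *)
Lemma multiplicity_retract (X E : lmodType L) (V : set X) c u :
  is_submod V -> len_le [set 0] V c -> lenle (restrict_scalars E) u ->
  multiplicity_ge (c * u).+1 E X ->
  exists (i : {linear E -> X}) (q : {linear X -> E}),
    cancel i q /\ forall x, V x -> q x = 0.
Proof.
move=> sV lenV lenE [i [p ip]].
have [|s [size_s _ sP]] := len_le_generated (is_submod0 X) sV _ lenV.
  exact: sub0_submod.
pose H : lmodType R := X -> restrict_scalars E.
pose K (r : seq X) : set H := [set h | forall x, x \in r -> h x = 0].
have sK r : is_submod (K r).
  split=> // a h h' h0 h'0 x xr.
  by change (a *: h x + h' x = 0); rewrite h0 // h'0 // scaler0 addr0.
have lenK r : len_le (K r) setT (size r * u).
  elim: r => [|b r IHr]; first by move=> h _.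
  rewrite mulSn addnC [(_ + _)%N]addnC.
  have ev : linear (fun h : H => h b) by [].
  have subK : K (b :: r) `<=` K r by move=> h h0 x xr; apply: h0; rewrite inE xr orbT.
  apply: (len_le_trans (sK r)) IHr => //.
  apply: (len_le_domain (f := to_linear ev)) lenE => //; first exact: is_submod0.
  by move=> h hr hb x; rewrite inE => /orP[/eqP ->|/hr].
have lenKs : len_le (K s) setT (c * u).
  by apply: len_leW (lenK s); rewrite leq_mul2r size_s orbT.
have [m m_cu mP] := len_le_dependent (x := fun k => p k : H) (sK s)
  (is_submodT H) (fun _ _ => I) lenKs (fun _ => I).
pose T : set H := [set h | exists q : {linear X -> E},
  (forall x, h x = q x) /\ forall e, q (i m e) = 0].
have sT : is_submod T.
  split; first by exists \0.
  move=> a h h' [q [hq q0]] [q' [hq' q'0]].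
  have lq : linear (fun x => (a%:A : L) *: q x + q' x).
    move=> b x y; rewrite !linearP !scalerDr addrACA; congr (_ + _).
    by rewrite !scalerA mulr_algl mulr_algr.
  exists (to_linear lq); split=> [x|e]; last first.
    by change ((a%:A : L) *: q (i m e) + q' (i m e) = 0); rewrite q0 q'0 scaler0 addr0.
  by change (a *: h x + h' x = (a%:A : L) *: q x + q' x); rewrite hq hq'.
have [||h [h' [Kh [q [h'q q0]] pE]]] := mP (msum (K s) T) (is_submod_sum (sK s) sT).
- exact: sub_msuml.
- move=> k km; apply: sub_msumr => //; exists (p k); split=> // e.
  rewrite ip ?(ltn_eqF km) //; lia.
have pmE x : p m x - q x = h x.
  have -> : p m x = h x + h' x by exact: (congr1 (fun f : H => f x) pE).
  by rewrite -h'q addrK.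
exists (i m), (p m \- q : {linear _ -> _}); split=> [e|x Vx] /=.
  by rewrite q0 subr0 ip ?eqxx.
have sKer := is_submod_ker (p m \- q : {linear _ -> _}).
apply: (sP _ sKer) Vx; first exact: sub0_submod.
by move=> y ys /=; rewrite pmE; apply: Kh.
Qed.

(** One generator of [V] is needed for each step of [Y / D], and each generates a
    factor module of [L / I]. *)
Lemma exists_complement (Y : lmodType L) (D : set Y) (I : set L^o) c t :
  is_submod D -> len_le D setT c ->
  len_le I setT t -> (forall y : Y, forall a, I a -> a *: y = 0) ->
  exists V, [/\ is_submod V, forall y, msum D V y & len_le [set 0] V (c * t)].
Proof.
move=> + + lenI I0; elim: c D => [|c IHc] D sD lenD.
  exists [set 0]; split=> // [|y]; first exact: is_submod0.
  by apply: sub_msuml; [exact: is_submod0|exact: lenD].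
have [TD|/existsNP[b /not_implyP[_ nDb]]] := pselect (setT `<=` D).
  exists [set 0]; split=> // [|y|]; [exact: is_submod0| |exact: len_le_refl].
  by apply: sub_msuml; [exact: is_submod0|exact: TD].
have sD' := is_submod_adjoin b sD.
have [|V [sV DV lenV]] := IHc _ sD'.
  apply: len_le_up lenD => //; first exact: sub_adjoin.
  by move=> sub; apply/nDb/sub/mem_adjoin.
exists (adjoin V b); split; first exact: is_submod_adjoin.
  move=> y; have [d [v [[a Dd] Vv ->]]] := DV y.
  exists (d - a *: b), (v + a *: b); split=> //; first by exists a; rewrite addrK.
  by rewrite [RHS]addrCA subrK addrC.
rewrite mulSn addnC; apply: (len_le_trans sV) lenV _ => //.
- exact: is_submod_adjoin.
- exact: sub0_submod.
- exact: sub_adjoin.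
- apply: (len_le_codomain (f := act b)) lenI => //.
  + by move=> a /I0 ab; rewrite [act b a]ab; apply: sV.1.
  + by move=> y [a Vy]; exists (y - a *: b), a; split; rewrite ?subrK.
Qed.

Lemma artin_algebra_generators : artin_algebra L ->
  exists n (g : nat -> L), forall x, span_from [set 0 : L] g n x.
Proof.
move=> [_ [n [g gP]]].
pose ext (T : zmodType) (h : 'I_n -> T) (k : nat) : T := oapp h 0 (insub k).
exists n, (ext _ g) => x; have [c ->] := gP x.
have -> : \sum_(i < n) c i *: g i = \sum_(i < n) ext _ c i *: ext _ g i.
  by apply: eq_bigr => i _; rewrite /ext valK.
exact: gspan_sum.
Qed.

Hypothesis artL : artin_algebra L.
Variable C : lmodType L -> Prop.
Hypotheses (subC : subcategory C) (clC : submodule_closed C)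
  (minC : ~ exists D, [/\ subcategory D, proper_subcat D C, infinite_subcat D &
                          submodule_closed D]).
Variables (X : nat -> lmodType L) (f : forall i, {linear X i -> X i.+1}).
Hypothesis chain : strict_chain C f.

Lemma chain_closed i : C (X i).
Proof. by have [[CX _] _ _] := chain i. Qed.

Lemma chain_indecomposable i : indecomposable (X i).
Proof.
have [irrX _ _] := chain i.
exact: subdirectly_irreducible_indecomposable irrX.
Qed.

(** If not, let [D] be maximal in [Y = X j] with zero intersection with [U].
    Its length grows with [j], since the length of [Y / D], an essential
    extension of [U], is bounded independently of [j]; but [D] has only finitely many indecomposable summands up to isomorphism,
    since it does not contain [Z].  So one of them has a multiplicity in [D]
    that forces it to split off [Y]. *)
Lemma chain_embeds_prod (U Z : lmodType L) i :
  subdirectly_irreducible C Z -> embeds U (X i) ->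
  exists j, embeds (U * Z)%type (X j).
Proof.
move=> irrZ UX; apply: contrapT => none.
have artR := artL.1; have [n [g gT]] := artin_algebra_generators artL.
have [I [t [sI lenI I0]]] := common_annihilator artR gT.
have [k0 lenU] := closed_lenle subC (closed_embeds subC clC UX (chain_closed i)).
have [u0 lenRU] := finite_restrict artR gT (is_submod0 U) (is_submodT U)
  (fun _ _ => Logic.I) lenU.
pose c := (t * u0)%N.
pose P W := C W /\ ~ embeds Z W.
have finP : finitely_many_iso_classes (fun W => P W /\ indecomposable W).
  apply: finitely_many_sub (finitely_many_not_containing subC clC minC irrZ).
  by move=> W [[CW nZW] iW].
have Psum (V W Y : lmodType L) : P Y -> isomorphic Y (V * W)%type -> P V /\ P W.
  move=> [CY nZY] YVW.
  have sub V' : embeds V' Y -> P V'.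
    move=> V'Y; split; first exact: closed_embeds V'Y CY.
    by move=> ZV'; apply: nZY; apply: embeds_trans V'Y.
  have VWY := embeds_iso (iso_sym YVW).
  split; apply: sub; apply: embeds_trans VWY.
    by exists (pairing idfun (\0 : {linear V -> W})) => x y [].
  by exists (pairing (\0 : {linear W -> V}) idfun) => x y [].
have [l lenP] : exists l, forall W, P W /\ indecomposable W -> lenle W l.
  by apply: finitely_many_bounded finP _ => W [[CW _] _]; apply: closed_lenle CW.
have [m [E PE]] := finP.
have [u lenE] : exists u, forall k, lenle (E k) l -> lenle (restrict_scalars (E k)) u.
  have /choice[v vP] k : exists v, lenle (E k) l -> lenle (restrict_scalars (E k)) v.
    have [lenEk|] := pselect (lenle (E k) l); last by exists 0%N.
    have [v lenv] := finite_restrict artR gT (is_submod0 (E k)) (is_submodT _)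
      (fun _ _ => Logic.I) lenEk.
    by exists v.
  exists (\max_k v k)%N => k /vP; apply: lenleW; exact: leq_bigmax.
pose N := (c * t * u)%N; pose B := (m * N * l)%N.
(* N is the multiplicity beyond which E k splits off Y, and B the length of D
   beyond which this multiplicity is attained by some k *)
pose j := maxn i (B + c + l).
have CY := chain_closed j; have iY := chain_indecomposable j.
set Y := X j in CY iY.
have longY k : lenle Y k -> (j < k)%N by apply: chain_lenle chain _ _.
have [kY lenY] := closed_lenle subC CY.
have [h hI] : embeds U Y := embeds_trans UX (chain_embeds chain (leq_maxl i (B + c + l))).
have [D [sD UD0 maxD]] := exists_maximal
  (P := fun D => forall x, D (h x) -> x = 0) (is_submod0 Y)
  (fun x hx => hI x 0 (etrans hx (esym (linear0 h)))) lenY.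
have PD : P (submod (of_set sD)).
  split; first exact: clC.
  move=> [q qI]; apply: none; exists j.
  exists ((h \o pfst U Z) \+ (sub_incl _ \o (q \o psnd U Z)) : {linear _ -> _}).
  apply: linear_injP => [[x z]] /= hq0.
  have hx : h x = - sub_incl _ (q z) by apply/eqP; rewrite -addr_eq0; apply/eqP.
  have x0 : x = 0.
    apply: UD0; rewrite hx; apply: is_submodN => //.
    exact/asboolP/(sub_incl_in (q z)).
  congr pair => //; apply: qI; rewrite linear0; apply: sub_incl_inj.
  by rewrite linear0 -[LHS]opprK -hx x0 linear0 oppr0.
have sU : is_submod (range h) by exact: is_submod_image.
have lenRD : @len_le R (restrict_scalars Y) D setT c.
  apply: (finite_essential_extension (U := range h) sD sU _ _ _ sI lenI).
  - by move=> _ [x _ <-] /UD0 ->; rewrite linear0.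
  - move=> V sV DV VD; apply: contrapT => no; apply: VD; apply: maxD => // x Vhx.
    apply: contrapT => x0; apply: no; exists (h x); split=> //.
    by rewrite -(linear0 h) => /hI.
  - apply: (len_le_codomain (f := restrict_map h)) lenRU => //.
    + exact: is_submod0.
    + by move=> _ ->; exact: linear0.
    + by move=> _ [x _ <-]; exists 0, x; rewrite add0r.
  - by move=> a y Ia; rewrite (I0 Y kY lenY y a Ia); apply: sD.1.
have lenD := len_le_restrict lenRD.
have [V [sV DV lenV]] := exists_complement sD lenD lenI (I0 Y kY lenY).
have nlenD : ~ lenle (submod (of_set sD)) B.
  move=> lenB; have : lenle Y (B + c).
    apply: (len_le_trans sD) _ lenD => //; first exact: sub0_submod.
    apply: (len_le_codomain (f := sub_incl _)) lenB => //.
    - exact: is_submod0.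
    - by move=> _ ->; exact: linear0.
    - move=> y Dy; have yD : y \in of_set sD by apply/asboolP.
      by exists 0, (Sub y yD); rewrite add0r.
  by move=> /longY; rewrite /j; lia.
have [kD lenkD] := closed_lenle subC PD.1.
have PEl W : P W -> indecomposable W -> lenle W l /\ exists k, isomorphic W (E k).
  by move=> PW iW; split; [exact: lenP|exact: PE].
have [k [iE lenEk mult]] := exists_multiplicity Psum PEl lenkD PD nlenD.
pose VD := sub_incl (of_set sD) @^-1` V.
have sVD : is_submod VD by exact: is_submod_preimage.
have lenVD : len_le [set 0] VD (c * t).
  apply: (len_le_domain (f := sub_incl (of_set sD)) (B' := [set 0]) (T' := V)) => //.
  - exact: is_submod0.
  - exact: sub0_submod.
  - by move=> d _ d0; apply: sub_incl_inj; rewrite linear0.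
have [p [q [pK q0]]] := multiplicity_retract sVD lenVD (lenE k lenEk) mult.
have YE := retract_extension sV DV pK q0 iY iE.1.
have := longY l (lenle_iso YE lenEk); rewrite /j; lia.
Qed.

(** Objects of [C] embed into finite products of subdirectly irreducible ones,
    and the factors are absorbed into the chain one at a time. *)
Lemma chain_cofinal (Y : lmodType L) : C Y -> exists i, embeds Y (X i).
Proof.
move=> CY; have [n lenY] := closed_lenle subC CY.
suff ind k (W : lmodType L) (g : {linear Y -> W}) i : embeds W (X i) ->
    len_le [set 0] [set y | g y = 0] k -> exists i, embeds Y (X i).
  apply: (ind n (X 0) \0 0%N); first by exists idfun.
  by apply: len_le_sub lenY.
elim: k W g i => [|k IHk] W g i WX leng.
  by exists i; apply: embeds_trans WX; exists g; apply: linear_injP => y /leng.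
have [g0|/existsNP[y /not_implyP[gy y0]]] := pselect (forall y, g y = 0 -> y = 0).
  by exists i; apply: embeds_trans WX; exists g; apply: linear_injP.
have [Z irrZ [h hy]] := cogenerated_by_subdirectly_irreducible subC clC CY y0.
have [j WZX] := chain_embeds_prod irrZ WX.
apply: (IHk _ (pairing g h) j) => //.
apply: leng.
- exact: is_submod_ker.
- by move=> _ ->; rewrite /= !linear0.
- by move=> x [].
- by move=> /(_ y gy) [].
Qed.

End Embedding.

(** * Minimal infinite submodule-closed subcategories *)

Theorem theorem2 (R : comNzRingType) (L : algType R)
    (C : lmodType L -> Prop) :
  artin_algebra L -> minimal_subcat C ->
  [/\ forall d : nat,
        finitely_many_iso_classes (fun X => C X /\ has_length X d),
      forall X : lmodType L, C X ->
        exists2 Y : lmodType L, C Y /\ indecomposable Y &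
          exists U : submodClosed Y, isomorphic X (submod U)
    & exists (M : lmodType L) (U : nat -> submodClosed M),
        [/\ forall i, C (submod (U i)) /\ indecomposable (submod (U i)),
            forall i, proper_submod (U i) (U i.+1),
            forall x : M, exists i, x \in U i,
            indecomposable M
          & forall X : lmodType L, C X <-> cogenerated M X]].
Proof.
move=> artL [subC infC clC minC].
have [X [f chain]] := exists_strict_chain subC clC infC minC.
have CX i : C (X i) := chain_closed chain i.
have iX i : indecomposable (X i) := chain_indecomposable subC clC chain i.
split.
- move=> d; apply: finitely_many_sub (finitely_many_lenle subC clC infC minC d).
  by move=> Y [CY /has_length_lenle].
- move=> Y /(chain_cofinal artL subC clC minC chain)[i [g gI]].
  by exists (X i) => //; exists (image_submod g); apply: iso_image.
have fI i : injective (f i) by have [_ fI _] := chain i.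
have [M [j [jI jf jM]]] := exists_colimit fI.
have jU i := iso_image (jI i).
exists M, (fun i => image_submod (j i)); split.
- by move=> i; split; [exact: (subcat_iso subC (jU i))|exact: indecomposable_iso (jU i) _].
- move=> i; split=> [m /asboolP[x _ <-]|sub].
    by apply/asboolP; exists (f i x).
  have [_ _ fS] := chain i; apply: fS => y.
  have /asboolP[x _ jxy] := sub _ (image_map_subproof (j i.+1) y).
  by exists x; apply: (jI i.+1); rewrite jf.
- by move=> m; have [i [x ->]] := jM m; exists i; apply: image_map_subproof.
- exact: (union_indecomposable subC chain jI jf jM).
- exact: (cogenerated_union subC clC chain jI jf jM minC).
Qed.
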